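(* Let $p=p(n)$ be any function with $0\le p(n)\le 1$, and let $G\sim G(n,p)$. Then, as $n\to\infty$, $$\Pr(G\text{ is not Hamiltonian})=(1+o(1))\Pr(\delta(G)<2).$$
   Context: $G(n,p)$ is the binomial (Erdős–Rényi) random graph on $n$ labelled vertices, in which each of the $\binom n2$ possible edges is present independently with probability $p$. $\delta(G)$ is the minimum degree of $G$. A graph is Hamiltonian if it contains a Hamilton cycle, i.e. a cycle through all its vertices. The notation $a_n=(1+o(1))b_n$ means that there is a sequence $\varepsilon_n\to 0$ as $n\to\infty$ with $a_n=(1+\varepsilon_n)b_n$. *)

(* Defs.v *)
From HB Require Import structures.
From mathcomp Require Import all_boot all_order all_algebra.
From mathcomp Require Import all_classical all_reals all_analysis.

Set Implicit Arguments.
Unset Strict Implicit.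
Unset Printing Implicit Defensive.

Import Order.TTheory GRing.Theory Num.Theory.
Import numFieldNormedType.Exports.

Local Open Scope classical_set_scope.
Local Open Scope ring_scope.

Definition edge (n : nat) := {e : {set 'I_n} | #|e| == 2%N}.

(* A simple graph on the labelled vertex set 'I_n is given by its edge set. *)
Definition graph (n : nat) := {set edge n}.

(* [adj G] is irreflexive, since [set u; u] has only one element. *)
Definition adj (n : nat) (G : graph n) : rel 'I_n :=
  fun u v => [exists e in G, val e == [set u; v]%SET].

Definition degree (n : nat) (G : graph n) (v : 'I_n) : nat :=
  #|[set u | adj G v u]%SET|.

(* Every degree is less than n, so the default value n of the iterated minimum
   only matters for n = 0, where it makes the minimum degree 0. *)
Definition min_degree (n : nat) (G : graph n) : nat :=
  \big[minn/n]_(v < n) degree G v.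

(* A cycle has at least three vertices. *)
Definition hamilton_cycle (n : nat) (G : graph n) (c : seq 'I_n) : bool :=
  [&& (2 < size c)%N, uniq c, cycle (adj G) c & [forall v, v \in c]].

(* A duplicate-free sequence meeting every vertex has length n, so it is enough
   to search among the n-tuples. *)
Definition hamiltonian (n : nat) (G : graph n) : bool :=
  [exists c : n.-tuple 'I_n, hamilton_cycle G c].

(* The probability of the event A when G is drawn from G(n,p): the law of G is
   the product, over all possible edges, of Bernoulli(p) laws. *)
Definition Pr_gnp (R : realType) (n : nat) (p : R) (A : pred (graph n)) : R :=
  \sum_(G : graph n | A G) \prod_(e : edge n) bernoulli_pmf p (e \in G).

(* Main.v *)
Require Import Defs.
From HB Require Import structures.
From mathcomp Require Import all_boot all_order all_algebra.
From mathcomp Require Import all_classical all_reals all_analysis.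
From mathcomp Require Import zify ring lra.
Import mathcomp.boot.fintype mathcomp.boot.finset.

Set Implicit Arguments.
Unset Strict Implicit.
Unset Printing Implicit Defensive.

Import Order.TTheory GRing.Theory Num.Theory.
Import numFieldNormedType.Exports.

(** A Hamiltonian graph has minimum degree at least 2, so the two probabilities differ by
    that of the atypical event: the minimum degree is at least 2 and yet there is no
    Hamilton cycle. This event must be shown negligible with respect to the event that
    the minimum degree is less than 2, uniformly in the edge probability.

    Write [1 - p = s ^+ 2]. Then the random graph is the union of two independent layers,
    each of them a random graph with edge probability [1 - s] (lemma [Pr_gnp_layers]).
    Let [H] consist of the first layer and of up to eight further edges at each vertex.
    An atypical graph falls in one of two cases (lemma [dichotomy]).

    Either [H] is not an expander. Then a smallest set [S] with fewer than [2 * #|S|]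
    neighbours spans, with its neighbours, a connected set [U] of less than [3 * #|S|]
    vertices, and no edge of the first layer joins [S] to the complement of [U]. If [S]
    has two or three vertices, no edge of the graph does, because [H] has kept all edges
    of vertices of small degree; and [S] has at least two vertices because the minimum
    degree is at least 2. A first moment computation over [S], [U] and a spanning tree of
    [U] bounds the probability of this case by a constant times [n * s ^+ (3 * n + 2)]
    (lemma [Pr_spot_le]).

    Or [H] is an expander. Add to [H] a longest path of the whole graph. By Posa's
    rotations (lemma [card_end_pairs]) quadratically many pairs of vertices are the two
    ends of a longest path, and none of these pairs is an edge, since it would close a
    longest path to a cycle, which is Hamiltonian or can be opened to a longer path
    (lemma [longest_ends_nonadj]). So some set of at most [9 * n] edges of the second
    layer determines, with the first layer, quadratically many pairs that must be absent
    from the second layer. The union bound (lemma [Pr_avoid]) gives a probability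
    exponentially small in [n ^ 2 * p].

    On the other hand, let [x = 1 / (n * q ^ (n - 1)) + 1 / q] where [q = 1 - p]. The
    second moment method for isolated vertices shows that the minimum degree is less than
    2 with probability at least [1 / x] (lemma [Pr_min_degree_lower]). If the average
    degree is so small that [expR (8 * n * (1 - s)) <= n ^ 3], then [x] tends to 1 and the
    minimum degree is less than 2 with probability tending to 1. Otherwise the bounds of both cases,
    multiplied by [x], tend to 0. The exponent [3 / 8] that separates the regimes may be
    any number between [1 / 3] and [1 / 2]: below [1 / 2] there are many isolated
    vertices, and above [1 / 3] the quantity [n * s ^ (3 * n)] is small. *)

Local Open Scope nat_scope.
Local Open Scope set_scope.

(** * Paths, expansion and cuts *)

Lemma exists_subset_card (T : finType) (X : {set T}) k : k <= #|X| ->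
  exists2 S : {set T}, S \subset X & #|S| = k.
Proof.
move=> /card_geqP [t [ut <- tX]].
exists [set x in t]; first by apply/subsetP=> x; rewrite inE => /tX.
by rewrite cardsE (card_uniqP ut).
Qed.

Section Graphs.
Variable n : nat.
Implicit Types (G H : graph n) (e : edge n) (u v : 'I_n) (s : seq 'I_n).

Lemma adjP G u v : reflect (exists2 e, e \in G & val e = [set u; v]) (adj G u v).
Proof.
apply: (iffP existsP) => [[e /andP[eG /eqP]]|[e eG eE]]; first by exists e.
by exists e; rewrite eG eE eqxx.
Qed.

Lemma adj_sym G : symmetric (adj G).
Proof. by move=> u v; apply/adjP/adjP=> -[e eG eE]; exists e; rewrite // setUC. Qed.

Lemma adj_neq G u v : adj G u v -> u != v.
Proof.
move=> /adjP[e _ eE]; apply/eqP=> uv; have := valP e.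
by rewrite eE uv setUid cards1.
Qed.

Lemma adjS G H u v : G \subset H -> adj G u v -> adj H u v.
Proof. by move=> /subsetP GH /adjP[e eG eE]; apply/adjP; exists e => //; apply: GH. Qed.

Lemma edge_ends e : exists u v, u != v /\ val e = [set u; v].
Proof. by have /cards2P[u [v [uv eE]]] := valP e; exists u, v. Qed.

Lemma edge_of u v : u != v -> exists e : edge n, val e = [set u; v].
Proof.
move=> uv; have c : #|[set u; v]| == 2 by rewrite cards2 uv.
by exists (exist (fun e : {set _} => #|e| == 2) _ c).
Qed.

Definition simple_path G s := uniq s && sorted (adj G) s.

Lemma simple_pathS G H s : G \subset H -> simple_path G s -> simple_path H s.
Proof.
move=> GH /andP[us ss]; rewrite /simple_path us /=.
by apply: sub_sorted ss => u v; apply: adjS.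
Qed.

Lemma simple_path_size G s : simple_path G s -> size s <= n.
Proof. by case/andP=> /card_uniqP <- _; rewrite -[n in _ <= n]card_ord max_card. Qed.

Definition longest G s := simple_path G s /\ forall s', simple_path G s' -> size s' <= size s.

Lemma longest_exists G : exists s, longest G s.
Proof.
pose P k := `[< exists s, simple_path G s /\ size s = k >].
have exP : exists k, P k by exists 0; apply/asboolP; exists [::].
have ubP k : P k -> k <= n by move/asboolP=> [s [/simple_path_size + <-]].
case: (ex_maxnP exP ubP) => k /asboolP[s [ps <-]] mx.
by exists s; split=> // s' ps'; apply: mx; apply/asboolP; exists s'.
Qed.

(** A longest path of [G] that survives in a subgraph [H] makes the longest paths of
    [H] longest in [G] too. This lets rotations be carried out in a sparse subgraph
    while the conclusions are drawn in the whole graph. *)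
Lemma longest_sub G H s s' : H \subset G -> simple_path H s -> longest G s ->
  longest H s' -> longest G s'.
Proof.
move=> HG Hs [_ mx] [Hs' mx']; split; first exact: simple_pathS Hs'.
by move=> t /mx /leq_trans; apply; apply: mx'.
Qed.

Lemma simple_path_rev G s : simple_path G (rev s) = simple_path G s.
Proof.
rewrite /simple_path rev_uniq rev_sorted; congr (_ && _).
by apply: eq_sorted => u v; rewrite adj_sym.
Qed.

Lemma longest_rev G s : longest G s -> longest G (rev s).
Proof. by move=> [ps mx]; split; rewrite ?simple_path_rev // size_rev. Qed.

Lemma simple_path_edges G s : simple_path G s ->
  exists B : graph n, [/\ B \subset G, #|B| <= size s & simple_path B s].
Proof.
rewrite /simple_path => /andP[us]; rewrite us /= => {us}.
case: s => [|x s] /=; first by exists set0; rewrite sub0set cards0.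
elim: s x => [|y s IH] x /=; first by exists set0; rewrite sub0set cards0.
case/andP=> /adjP[e eG eE] /IH [B [BG cB sB]].
exists (e |: B); rewrite subUset sub1set eG BG cardsU1; split=> //.
  exact: leq_add (leq_b1 _) cB.
apply/andP; split; first by apply/adjP; exists e => //; rewrite setU11.
by apply: sub_path sB => u v; apply: adjS; apply: subsetUr.
Qed.

Definition nbr G (S : {set 'I_n}) := [set v | (v \notin S) && [exists u in S, adj G u v]].

Lemma nbrP G (S : {set 'I_n}) v :
  reflect (v \notin S /\ exists2 u, u \in S & adj G u v) (v \in nbr G S).
Proof.
rewrite inE; apply: (iffP andP) => -[vS].
  by move=> /existsP[u /andP[uS uv]]; split=> //; exists u.
by case=> u uS uv; split=> //; apply/existsP; exists u; rewrite uS.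
Qed.

Lemma nbrS G H (S : {set 'I_n}) : G \subset H -> nbr G S \subset nbr H S.
Proof.
move=> GH; apply/subsetP=> v /nbrP[vS [u uS uv]]; apply/nbrP; split=> //.
by exists u => //; apply: adjS uv.
Qed.

Definition expander m G :=
  forall S : {set 'I_n}, 0 < #|S| <= m -> 2 * #|S| <= #|nbr G S|.

Lemma expanderS m G H : G \subset H -> expander m G -> expander m H.
Proof. by move=> GH xG S /xG /leq_trans; apply; apply/subset_leq_card/nbrS. Qed.

Definition cut_connected G := forall A : {set 'I_n}, A != set0 -> A != setT ->
  exists u w, [/\ u \in A, w \notin A & adj G u w].

(** A side of a cut without crossing edges contains the neighbourhoods of all its
    subsets, so expansion forces it to have at least [3 * m] vertices, which is more
    than half of them. *)
Lemma expander_cut m G : 0 < m -> n < 6 * m -> expander m G -> cut_connected G.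
Proof.
move=> m0 nm xG A A0 AT; apply: contrapT => nex.
have noedge u w : u \in A -> w \notin A -> ~~ adj G u w.
  by move=> uA wA; apply/negP=> uw; apply: nex; exists u, w.
have big (X : {set 'I_n}) : X != set0 ->
   (forall u w, u \in X -> w \notin X -> ~~ adj G u w) -> 3 * m <= #|X|.
  move=> X0 nX.
  have [S SX cS] := exists_subset_card (geq_minr m #|X|).
  have /xG cN : 0 < #|S| <= m.
    by rewrite cS geq_minl andbT leq_min m0 card_gt0.
  have sub : S :|: nbr G S \subset X.
    rewrite subUset SX; apply/subsetP=> v /nbrP[_ [u uS uv]].
    by apply/negPn/negP=> vX; have := nX u v (subsetP SX u uS) vX; rewrite uv.
  have := subset_leq_card sub; rewrite cardsU.
  have -> : S :&: nbr G S = set0.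
    by apply/setP=> v; rewrite !inE; case: (v \in S).
  have X1 : 0 < #|X| by rewrite card_gt0.
  move: cN; rewrite cards0 cS; lia.
have c1 := big A A0 noedge.
have c2 : 3 * m <= #|~: A|.
  apply: big; first by rewrite -setCT (inj_eq (can_inj (@setCK _))).
  by move=> u w; rewrite !inE negbK => uA wA; rewrite adj_sym; apply: noedge.
have := cardsC A; rewrite card_ord; lia.
Qed.

(** Joining the ends of a longest path closes it into a cycle. If this cycle misses a
    vertex, then by connectedness an edge leaves it, and cutting the cycle open there
    gives a longer path. *)
Lemma longest_ends_nonadj G x s : 2 < n -> cut_connected G -> ~~ hamiltonian G ->
  longest G (x :: s) -> ~~ adj G (last x s) x.
Proof.
move=> n3 cG nH [/andP[us ss] mx]; apply/negP=> cl.
have cyc : cycle (adj G) (x :: s) by rewrite /= rcons_path cl andbT.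
have [allv|/forallPn /= [w0 w0s]] := boolP [forall v, v \in x :: s].
  case/negP: nH; apply/existsP.
  have sz : size (x :: s) == n.
    rewrite -(card_uniqP us) -[X in _ == X]card_ord; apply/eqP/eq_card => v.
    by rewrite (forallP allv v).
  exists (Tuple sz); rewrite /hamilton_cycle /= -/(cycle (adj G) (x :: s)).
  by move: us cyc allv => /= -> /= -> ->; move: sz => /= /eqP ->; rewrite n3.
have [] := cG [set v in x :: s].
- by apply/set0Pn; exists x; rewrite !inE eqxx.
- by apply/eqP=> /setP/(_ w0); rewrite in_set in_setT (negPf w0s).
move=> u [w [+ + uw]]; rewrite !in_set => uS wS.
case: (rot_to uS) => i s' rotE.
have ps : simple_path G (w :: u :: s').
  apply/andP; split.
    rewrite cons_uniq -rotE mem_rot wS rot_uniq; exact: us.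
  rewrite /= adj_sym uw /=; have : cycle (adj G) (u :: s') by rewrite -rotE rot_cycle.
  by rewrite /= rcons_path => /andP[].
by have := mx _ ps; rewrite [size _]/= -[(size s').+1]/(size (u :: s')) -rotE size_rot ltnn.
Qed.

End Graphs.

(** * Rotations of longest paths *)

Lemma sorted_cat_cons (T : Type) (e : rel T) (s1 : seq T) z s2 :
  sorted e (s1 ++ z :: s2) = sorted e (rcons s1 z) && path e z s2.
Proof. by case: s1 => //= a s1; rewrite rcons_path cat_path /= andbA. Qed.

Lemma path_rev (T : eqType) (e : rel T) z (s : seq T) : symmetric e ->
  (s = [::] \/ e (last z s) z) -> path e z s -> path e z (rev s).
Proof.
move=> es; case/lastP: s => [|t y] //; rewrite last_rcons => -[|eyz]; first by case: t.
move=> /path_sorted; have -> : sorted e (rcons t y) = sorted e (rev (rcons t y)).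
  by rewrite rev_sorted; apply: eq_sorted => u v; rewrite es.
by rewrite rev_rcons /= es eyz.
Qed.

Section Posa.
Variables (n : nat) (G : graph n).
Implicit Types (s t : seq 'I_n) (u v x y z a b : 'I_n).

(** Posa rotations: the last vertex of the path is joined to an inner vertex [z], and
    the part after [z] is reversed. *)
Inductive rotated (s0 : seq 'I_n) : seq 'I_n -> Prop :=
| Rotated0 : rotated s0 s0
| RotatedS s1 z s2 : rotated s0 (s1 ++ z :: s2) -> adj G (last z s2) z ->
    rotated s0 (s1 ++ z :: rev s2).

Lemma rotated_perm s0 s : rotated s0 s -> perm_eq s s0.
Proof.
elim=> // s1 z s2 _ + _; apply: perm_trans.
by rewrite perm_cat2l perm_cons perm_rev.
Qed.

Lemma rotated_head s0 s v : rotated s0 s -> head v s = head v s0.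
Proof. by elim=> // -[|a s1] z s2 _. Qed.

Lemma rotated_simple_path s0 s : simple_path G s0 -> rotated s0 s -> simple_path G s.
Proof.
move=> p0 rs; rewrite /simple_path (perm_uniq (rotated_perm rs)); case/andP: p0 => -> /= p0.
elim: rs => // s1 z s2 _ + az; rewrite !sorted_cat_cons => /andP[-> /=].
by apply: path_rev; [apply: adj_sym|right].
Qed.

Lemma rotated_longest s0 s : longest G s0 -> rotated s0 s -> longest G s.
Proof.
move=> [p0 mx] rs; split; first exact: rotated_simple_path rs.
by rewrite (perm_size (rotated_perm rs)).
Qed.

Definition rot_ends s0 := [set x | `[< exists s, rotated s0 (rcons s x) >]].

Lemma rot_endsP s0 x : reflect (exists s, rotated s0 (rcons s x)) (x \in rot_ends s0).
Proof. by rewrite inE; apply: asboolP. Qed.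

(** A path that is sorted for this relation never steps between [a] and [b]. Phrasing
    the absence of the edge [ab] as sortedness makes it behave under concatenation and
    reversal as any other path property. *)
Definition apart a b : rel 'I_n :=
  fun u v => ~~ ((u == a) && (v == b) || (u == b) && (v == a)).

Lemma apart_sym a b : symmetric (apart a b).
Proof. by move=> u v; rewrite /apart orbC andbC [X in _ || X]andbC. Qed.

(** The only edge that a rotation removes ends at the new endpoint of the path. Hence
    an edge of the original path that misses all endpoints is never destroyed. *)
Lemma rotated_apart s0 s a b : a \notin rot_ends s0 -> b \notin rot_ends s0 ->
  rotated s0 s -> sorted (apart a b) s -> sorted (apart a b) s0.
Proof.
move=> aR bR; elim=> // s1 z s2 rs IH az sab; apply: IH; move: sab.
rewrite !sorted_cat_cons => /andP[-> /=].
case: s2 rs az => //= y s2 rs az sab.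
have yR : y \in rot_ends s0.
  apply/rot_endsP; exists (s1 ++ z :: rev s2).
  by have := RotatedS rs az; rewrite rev_cons -rcons_cons -rcons_cat.
have yab w : apart a b w y.
  apply/negP=> /orP[] /andP[_ /eqP yE]; first by rewrite -yE yR in bR.
  by rewrite -yE yR in aR.
suff : path (apart a b) z (rev (rev (y :: s2))) by rewrite revK.
apply: path_rev; first exact: apart_sym.
  by right; rewrite rev_cons last_rcons apart_sym.
exact: sab.
Qed.

Lemma sorted_apart_cat s1 z y s2 b : uniq (s1 ++ z :: y :: s2) -> b != y ->
  (s1 = [::] \/ last z s1 != b) -> sorted (apart z b) (s1 ++ z :: y :: s2).
Proof.
rewrite cat_uniq => /and3P[_ /hasPn zs1 /= /and3P[zs2 _ _]] bny lb.
have free t : z \notin t -> sorted (apart z b) t.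
  move=> zt; case: t zt => //= x t; elim: t x => //= w t IH x.
  rewrite !inE !negb_or => /and3P[zx zw zt]; rewrite IH ?inE ?negb_or ?zw // andbT.
  by rewrite /apart eq_sym (negPf zx) [w == z]eq_sym (negPf zw) andbF.
have zs1' : z \notin s1 by apply: (zs1 z); rewrite inE eqxx.
rewrite sorted_cat_cons; apply/andP; split.
  case: lb => [-> //|lb]; case: s1 zs1' lb {zs1} => //= a s1 za lb.
  rewrite rcons_path; have := free _ za; rewrite /= => -> /=.
  rewrite /apart (negPf lb) orbF negb_and; apply/orP; left.
  by apply: contra za => /eqP <-; apply: mem_last.
rewrite /=; have /= -> := free _ zs2; rewrite andbT /apart eqxx /= negb_or eq_sym bny /=.
by rewrite negb_and; move: zs2; rewrite inE negb_or eq_sym => /andP[-> _]; rewrite orbT.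
Qed.

Lemma not_sorted_apart s1 a b s2 : ~~ sorted (apart a b) (s1 ++ a :: b :: s2).
Proof. by rewrite sorted_cat_cons /= /apart !eqxx /= andbF. Qed.

Lemma not_sorted_apart' s1 a b s2 : ~~ sorted (apart b a) (s1 ++ a :: b :: s2).
Proof. by rewrite sorted_cat_cons /= /apart !eqxx /= orbT andbF. Qed.

Definition succ_in s x := nth x s (index x s).+1.
Definition pred_in s x := nth x s (index x s).-1.

Lemma succ_in_cat s1 a b s2 : uniq (s1 ++ a :: b :: s2) ->
  succ_in (s1 ++ a :: b :: s2) a = b.
Proof.
rewrite cat_uniq => /and3P[_ /hasPn ns1 _].
have as1 : a \notin s1 by apply: (ns1 a); rewrite inE eqxx.
rewrite /succ_in index_cat (negPf as1) /= eqxx addn0 nth_cat ltnNge leqnSn /=.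
by rewrite subSn // subnn.
Qed.

Lemma pred_in_cat s1 a b s2 : uniq (s1 ++ a :: b :: s2) ->
  pred_in (s1 ++ a :: b :: s2) b = a.
Proof.
rewrite -cat_rcons cat_uniq => /and3P[us1 /hasPn ns1 _].
have bs1 : b \notin rcons s1 a by apply: (ns1 b); rewrite inE eqxx.
rewrite /pred_in index_cat (negPf bs1) /= eqxx addn0 size_rcons /= nth_cat size_rcons ltnSn.
by rewrite nth_rcons ltnn eqxx.
Qed.

(** Posa's lemma. If neither path-neighbour of [z] is an endpoint, then both stay next
    to [z] in every rotated path. But if [z] is adjacent to an endpoint [x], a further
    rotation makes the successor of [z] an endpoint. *)
Lemma nbr_rot_ends s0 x0 z : longest G (rcons s0 x0) ->
  z \in nbr G (rot_ends (rcons s0 x0)) ->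
  exists y, [/\ y \in rot_ends (rcons s0 x0) &
     (z == pred_in (rcons s0 x0) y) ||
     (y != x0) && (z == succ_in (rcons s0 x0) y)].
Proof.
set p := rcons s0 x0; set R := rot_ends p => lp /nbrP[zR [x /rot_endsP[s' rs] xz]].
have [ps' mx'] := rotated_longest lp rs.
have /andP[us' _] := ps'.
have /andP[up _] : simple_path G p by case: lp.
have x0R : x0 \in R by apply/rot_endsP; exists s0; apply: Rotated0.
have zs' : z \in rcons s' x.
  apply/negPn/negP=> zs'; have : simple_path G (rcons (rcons s' x) z).
    case/andP: ps' => _ ss'; rewrite /simple_path rcons_uniq zs' us' /=.
    by rewrite -(cats1 (rcons s' x)) cat_rcons sorted_cat_cons ss' /= xz.
  by move/mx'; rewrite size_rcons ltnn.
have zp : z \in p by rewrite -(perm_mem (rotated_perm rs)).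
have xR : x \in R by apply/rot_endsP; exists s'.
have znx : z != x by apply: contraNneq zR => ->.
(* rotating at [z] will turn its successor [y] into an endpoint *)
have [s1 [y [s2 s'E]]] : exists s1 y s2, rcons s' x = s1 ++ z :: y :: s2.
  move: zs'; rewrite mem_rcons inE (negPf znx) /= => /splitPr[s1 s2].
  case: s2 => [|y s2]; first by exists s1, x, [::]; rewrite rcons_cat.
  by exists s1, y, (rcons s2 x); rewrite rcons_cat.
have lastx : last y s2 = x.
  by have := congr1 (last z) s'E; rewrite last_rcons last_cat.
have yR : y \in R.
  apply/rot_endsP; exists (s1 ++ z :: rev s2).
  have /RotatedS : rotated p (s1 ++ z :: (y :: s2)) by rewrite -s'E.
  rewrite /= lastx => /(_ xz).
  by rewrite rev_cons -rcons_cons -rcons_cat.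
have ynz : y != z by apply: contraNneq zR => <-.
rewrite s'E in rs us'.
(* a path-neighbour of [z] that is not an endpoint must still precede [z] *)
have key b : b \notin R -> ~~ sorted (apart z b) p -> s1 <> [::] /\ last z s1 = b.
  move=> bR np; have bny : b != y by apply: contraNneq bR => ->.
  have np' : ~~ sorted (apart z b) (s1 ++ z :: y :: s2).
    by apply: contra np; apply: rotated_apart rs.
  split; first by move=> s10; move: np'; rewrite sorted_apart_cat //; left.
  by apply/eqP/negPn/negP=> lb; move: np'; rewrite sorted_apart_cat //; right.
have [t1 [z' [t2 pE]]] : exists t1 z' t2, p = t1 ++ z :: z' :: t2.
  have znx0 : z != x0 by apply: contraNneq zR => ->.
  move: zp; rewrite mem_rcons inE (negPf znx0) /= /p => /splitPr[t1 t2].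
  case: t2 => [|w t2]; first by exists t1, x0, [::]; rewrite rcons_cat.
  by exists t1, w, (rcons t2 x0); rewrite rcons_cat.
have [z'R|z'R] := boolP (z' \in R).
  by exists z'; split=> //; rewrite pE pred_in_cat -?pE ?eqxx.
have [s1n ls1] : s1 <> [::] /\ last z s1 = z'.
  by apply: key z'R _; rewrite pE not_sorted_apart.
case/lastP: t1 pE => [|t1 z''] pE.
  case: s1 s1n ls1 rs us' {s'E key} => // w s1 _ _ rs us'.
  have := rotated_head z rs; rewrite pE /= => wz.
  by move: us'; rewrite wz /= mem_cat in_cons eqxx orbT.
have [z''R|z''R] := boolP (z'' \in R).
  exists z''; split=> //; apply/orP; right.
  rewrite pE cat_rcons succ_in_cat; last by rewrite -cat_rcons -pE.
  rewrite eqxx andbT.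
  apply/eqP=> z''x; have := up; rewrite pE cat_rcons cat_uniq => /and3P[_ _ /=].
  have : last z' t2 = x0.
    by have := congr1 (last z) pE; rewrite last_rcons last_cat.
  by rewrite z''x => <-; rewrite -[z :: _]/([:: z] ++ z' :: t2) mem_cat mem_last orbT.
have [_ ls1'] : s1 <> [::] /\ last z s1 = z''.
  by apply: key z''R _; rewrite pE cat_rcons not_sorted_apart'.
move: up; rewrite pE cat_rcons -ls1' ls1 cat_uniq => /and3P[_ _ /=].
by rewrite !inE eqxx orbT.
Qed.

(** The last vertex of the path has no successor, so by Posa's lemma the set of
    endpoints has fewer than twice as many neighbours as elements: it is too large for
    the expansion hypothesis. *)
Lemma card_rot_ends m s0 x0 : 0 < m -> expander m G -> longest G (rcons s0 x0) ->
  m < #|rot_ends (rcons s0 x0)|.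
Proof.
move=> m0 xG lp; set p := rcons s0 x0; set R := rot_ends p.
have x0R : x0 \in R by apply/rot_endsP; exists s0; apply: Rotated0.
rewrite ltnNge; apply/negP=> cR.
have /xG : 0 < #|R| <= m by rewrite cR andbT card_gt0; apply/set0Pn; exists x0.
have : nbr G R \subset [set pred_in p y | y in R] :|: [set succ_in p y | y in R :\ x0].
  apply/subsetP=> z /(nbr_rot_ends lp)[y [yR /orP[/eqP->|/andP[yx /eqP->]]]].
    by apply/setUP; left; apply: imset_f.
  by apply/setUP; right; apply: imset_f; rewrite in_setD1 yx.
move=> /subset_leq_card; rewrite cardsU.
have : #|[set pred_in p y | y in R]| <= #|R| by apply: leq_imset_card.
have : #|[set succ_in p y | y in R :\ x0]| <= #|R :\ x0| by apply: leq_imset_card.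
have := cardsD1 x0 R; rewrite x0R add1n.
move: #|nbr G R| #|R| #|R :\ x0| #|_ @: R| #|_ @: (_ :\ _)| #|_ :&: _| => a b c d e f.
lia.
Qed.

Definition far_ends v := [set x | `[< exists s, longest G (v :: s) /\ last v s = x >]].

Lemma card_far_ends m v s : 0 < m -> expander m G -> longest G (v :: s) ->
  m < #|far_ends v|.
Proof.
move=> m0 xG lp; have := lp; rewrite lastI => lp'.
apply: leq_trans (card_rot_ends m0 xG lp') _; apply/subset_leq_card/subsetP => x.
rewrite -lastI => /rot_endsP[t rt]; rewrite inE; apply/asboolP.
have := rotated_longest lp rt; have := rotated_head v rt.
case: t rt => [|w t] rt /=.
  by move=> xv; exists [::]; rewrite -xv.
by move=> wv; exists (rcons t x); rewrite last_rcons -wv.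
Qed.

(** The pairs usually called boosters: adding any of them to a connected graph creates a
    Hamilton cycle or a longer path. *)
Definition end_pairs : graph n :=
  [set e | `[< exists x s, longest G (x :: s) /\ val e = [set x; last x s] >]].

(** Each of the more than [m] far ends of a longest path can itself be taken as the
    starting point of a longest path with more than [m] far ends. *)
Lemma card_end_pairs m : 0 < n -> 0 < m -> expander m G -> m * m <= 4 * #|end_pairs|.
Proof.
move=> n0 m0 xG.
have [[|v s] lp] := longest_exists G.
  case: lp => _ /(_ [:: Ordinal n0]); rewrite /simple_path /=; by move/(_ isT).
pose P := [set uv | (uv.1 \in far_ends v) && (uv.2 \in far_ends uv.1)].
have cP : m * m <= #|P|.
  have -> : #|P| = \sum_(u in far_ends v) #|far_ends u|.
    under eq_bigr do rewrite -sum1_card.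
    rewrite -sum1_card pair_big_dep /=; apply: eq_bigl => -[a b].
    by rewrite /P !inE.
  apply: (@leq_trans (\sum_(u in far_ends v) m)).
    by rewrite sum_nat_const leq_mul2r (ltnW (card_far_ends m0 xG lp)) orbT.
  apply: leq_sum => u; rewrite inE => /asboolP[t [lt tu]].
  apply: ltnW; have := longest_rev lt; rewrite lastI tu rev_rcons => lt'.
  exact: card_far_ends lt'.
apply: (leq_trans cP).
(* each edge is counted for the four ordered pairs with both entries in it *)
have sub : P \subset \bigcup_(e in end_pairs) finset.setX (val e) (val e).
  apply/subsetP=> -[u w]; rewrite inE /= => /andP[_ wu].
  have [uw|uw] := eqVneq u w.
    move: (wu); rewrite inE => /asboolP[t [lt tu]].
    case: t lt tu => [|a t] lt tu; last first.
      have [/andP[/= /andP[ua _] _] _] := lt; case/negP: ua.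
      by rewrite uw -tu; exact: (mem_last a t).
    have := card_far_ends m0 xG lt.
    suff -> : far_ends u = [set u] by rewrite cards1; lia.
    apply/setP=> y; rewrite !inE; apply/asboolP/eqP => [[t [lt' <-]]|->]; last by exists [::].
    by case: t lt' => // a t [/lt.2].
  have [e eE] := edge_of uw.
  apply/bigcupP; exists e; last by rewrite in_setX eE !inE !eqxx orbT.
  rewrite inE; apply/asboolP; move: wu; rewrite inE => /asboolP[t [lt tu]].
  by exists u, t; rewrite tu.
apply: (leq_trans (subset_leq_card sub)).
have leU (A : graph n) : #|\bigcup_(e in A) finset.setX (val e) (val e)| <= 4 * #|A|.
  rewrite mulnC -sum_nat_const.
  apply: (big_ind2 (fun (X : {set 'I_n * 'I_n}) k => #|X| <= k)); first by rewrite cards0.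
    by move=> X a Y b ca cb; rewrite cardsU; lia.
  by move=> e _; rewrite cardsX (eqP (valP e)).
exact: leU.
Qed.

End Posa.

(** * Two obstructions to Hamiltonicity at minimum degree two *)

Section Dichotomy.
Variable n : nat.
Implicit Types (G H : graph n) (S U X : {set 'I_n}) (T B : graph n).

Lemma min_degree_le G v : min_degree G <= degree G v.
Proof.
rewrite /min_degree; elim: index_enum (mem_index_enum v) => //= w r IH.
rewrite inE big_cons => /predU1P[->|/IH]; first exact: geq_minl.
by apply: leq_trans; apply: geq_minr.
Qed.

Definition inside U : graph n := [set e : edge n | val e \subset U].

Definition boundary S U : graph n :=
  [set e : edge n | [exists u in S, exists w in ~: U, val e == [set u; w]]].

(** The edges of a spanning tree, of which only the number matters to a first moment
    bound. *)
Lemma spanning_edges G U : U != set0 ->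
  (forall X, X \subset U -> X != set0 -> X != U ->
     exists u w, [/\ u \in X, w \in U :\: X & adj G u w]) ->
  exists T, [/\ T \subset G, T \subset inside U & #|T|.+1 = #|U|].
Proof.
case/set0Pn=> x0 x0U cU.
suff H k : 0 < k <= #|U| -> exists X T, [/\ X \subset U, #|X| = k,
    T \subset G, T \subset inside X & #|T|.+1 = k].
  have [|X [T [XU cX TG TX cT]]] := H #|U|.
    by rewrite leqnn andbT card_gt0; apply/set0Pn; exists x0.
  exists T; split=> //; suff <- : X = U by [].
  by apply/eqP; rewrite eqEcard XU cX leqnn.
elim: k => [//|[|k] IH] kU.
  exists [set x0], set0; rewrite sub1set x0U cards1 cards0 !sub0set; by split.
have [|X [T [XU cX TG TX cT]]] := IH; first by rewrite /= ltnW.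
have [||u [w [uX]]] := cU X XU.
- by rewrite -card_gt0 cX.
- by apply/eqP=> XE; move: kU; rewrite -XE cX ltnn.
rewrite in_setD => /andP[wX wU] /adjP[e eG eE].
have wXX : X \subset w |: X by apply: finset.subsetUr.
exists (w |: X), (e |: T); split.
- by rewrite subUset sub1set wU.
- by rewrite cardsU1 wX cX.
- by rewrite subUset sub1set eG.
- rewrite subUset sub1set inE eE subUset !sub1set !inE uX eqxx orbT /=.
  apply: subset_trans TX _; apply/subsetP=> f; rewrite !inE => fX.
  exact: subset_trans fX wXX.
rewrite cardsU1; suff -> : e \notin T by rewrite -cT.
apply: contra wX => /(subsetP TX); rewrite inE eE subUset !sub1set.
by case/andP.
Qed.

(** A sparse subgraph in which low degree is inherited from the whole graph: a vertex of
    degree less than [d] in it has lost no edge. *)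
Lemma keep_edges d G : exists B, [/\ B \subset G, #|B| <= d * n &
  forall v, d <= degree B v \/ forall u, adj G v u -> adj B v u].
Proof.
have loc v : exists C : graph n, [/\ C \subset G, #|C| <= d &
    d <= degree C v \/ forall u, adj G v u -> adj C v u].
  pose N := [set u | adj G v u].
  have [A AN cA] := exists_subset_card (geq_minr d #|N|).
  pose C := [set e in G | [exists u in A, val e == [set v; u]]].
  have AC u : u \in A -> adj C v u.
    move=> uA; have := subsetP AN u uA; rewrite inE => /adjP[e eG eE].
    apply/adjP; exists e => //; rewrite inE eG; apply/existsP; exists u.
    by rewrite uA eE eqxx.
  exists C; split.
  - by apply/subsetP=> e; rewrite inE => /andP[].
  - rewrite -(card_imset _ val_inj).
    apply: leq_trans (_ : #|[set [set v; u] | u in A]| <= _); last first.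
      by apply: leq_trans (leq_imset_card _ _) _; rewrite cA geq_minl.
    apply/subset_leq_card/subsetP => _ /imsetP[e + ->].
    rewrite inE => /andP[_ /existsP[u /andP[uA /eqP->]]].
    exact: imset_f.
  have [dN|Nd] := leqP d #|N|; [left|right].
    rewrite /degree -(minn_idPl dN) -cA; apply/subset_leq_card/subsetP=> u uA.
    by rewrite inE; apply: AC.
  move=> u uN; apply: AC; suff -> : A = N by rewrite inE.
  by apply/eqP; rewrite eqEcard AN cA (minn_idPr (ltnW Nd)) leqnn.
have [C HC] := choice loc.
exists (\bigcup_v C v); split.
- by apply/bigcupsP=> v _; case: (HC v).
- rewrite mulnC -[n in n * _]card_ord -sum_nat_const.
  apply: (big_ind2 (fun (X : {set edge n}) k => #|X| <= k)); first by rewrite cards0.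
    by move=> X a Y b ca cb; rewrite cardsU; lia.
  by move=> v _; case: (HC v).
move=> v; have sub : C v \subset \bigcup_v C v by apply: bigcup_sup.
have [_ _ [dC|aC]] := HC v; [left|right].
  apply: leq_trans dC _; apply/subset_leq_card/subsetP=> u; rewrite !inE.
  exact: adjS.
by move=> u /aC; apply: adjS.
Qed.

(** The shape of a place where expansion fails: [U] is [S] together with its few
    neighbours, and [T] is the edge set of a spanning tree of [U]. *)
Definition spot m S U T :=
  [&& S \subset U, 2 <= #|S| <= m, #|U| < 3 * #|S|, T \subset inside U & #|T|.+1 == #|U|].

(** When [S] has at most three vertices, all edges from [S] to the outside of [U] must
    be missing in both layers; the doubled cost is what makes these small sets unlikely
    enough. Larger sets can afford to be cut off in the first layer only. *)
Definition isolated_spot G1 G2 S U T :=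
  [&& T \subset G1 :|: G2, [disjoint boundary S U & G1] &
   (#|S| <= 3) ==> [disjoint boundary S U & G2]].

Lemma boundary_disjoint G H S : [disjoint boundary S (S :|: nbr H S) & G] =
  [forall u in S, forall w, adj G u w ==> (w \in S :|: nbr H S)].
Proof.
apply/idP/forall_inP => [dj u uS|all].
  apply/forallP=> w; apply/implyP=> /adjP[e eG eE]; apply/negPn/negP=> wU.
  have eb : e \in boundary S (S :|: nbr H S).
    rewrite inE; apply/existsP; exists u; rewrite uS; apply/existsP; exists w.
    by rewrite finset.in_setC wU eE eqxx.
  by have := disjointFr dj eb; rewrite eG.
apply/pred0P=> e /=; apply/negP=> /andP[+ eG].
rewrite inE => /existsP[u /andP[uS /existsP[w /andP[wU /eqP eE]]]].
have /forallP/(_ w)/implyP h := all u uS.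
by move: wU; rewrite finset.in_setC h //; apply/adjP; exists e.
Qed.

(** Take a non-expanding set [S] of minimum size. If its closed neighbourhood [U] were
    disconnected, one of the two parts of [S] would be a smaller non-expanding set. If
    [S] has at most three vertices then they have degree less than 8 in [H], so that [H]
    contains all their edges; in particular [S] has more than one vertex, because the
    minimum degree is at least 2. *)
Lemma nonexpander_spot m G1 G2 H : 2 <= min_degree (G1 :|: G2) ->
  G1 \subset H -> H \subset G1 :|: G2 ->
  (forall v, 8 <= degree H v \/ forall u, adj (G1 :|: G2) v u -> adj H v u) ->
  ~ expander m H ->
  exists S U T, spot m S U T && isolated_spot G1 G2 S U T.
Proof.
set G := G1 :|: G2 => dG G1H HG keep nx.
pose P S := (0 < #|S| <= m) && (#|nbr H S| < 2 * #|S|).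
have [S0 PS0] : exists S, P S.
  apply: contrapT => nP; apply: nx => S cS; rewrite leqNgt; apply/negP=> lt.
  by apply: nP; exists S; rewrite /P cS.
case: (arg_minnP (fun S => #|S|) PS0) => S /andP[/andP[S0' Sm] cN] minS.
pose W := nbr H S; pose U := S :|: W.
have cU : #|U| = #|S| + #|W|.
  rewrite cardsU; suff -> : S :&: W = set0 by rewrite cards0 subn0.
  by apply/setP=> v; rewrite !inE; case: (v \in S).
have SU : S \subset U by apply: finset.subsetUl.
have stepU u w : u \in S -> adj H u w -> w \in U.
  move=> uS uw; rewrite in_setU; case: (boolP (w \in S)) => //= wS.
  by apply/nbrP; split=> //; exists u.
have conn X : X \subset U -> X != set0 -> X != U ->
     exists u w, [/\ u \in X, w \in U :\: X & adj H u w].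
  move=> XU X0 XneU; apply: contrapT => nex.
  have nocross u w : u \in X -> w \in U :\: X -> ~~ adj H u w.
    by move=> uX wX; apply/negP=> uw; apply: nex; exists u, w.
  have D0 : U :\: X != set0.
    apply: contra XneU; rewrite finset.setD_eq0 => UX; by rewrite eqEsubset XU.
  have meet (Y : {set 'I_n}) : Y \subset U -> Y != set0 ->
      (forall u w, u \in Y -> w \in U :\: Y -> ~~ adj H u w) -> S :&: Y != set0.
    move=> YU /set0Pn[y yY] nY; have := subsetP YU y yY.
    rewrite in_setU => /orP[yS|/nbrP[yS [u uS uy]]].
      by apply/set0Pn; exists y; rewrite inE yS.
    apply/set0Pn; exists u; rewrite inE uS /=; apply/negPn/negP=> uY.
    have := nY y u yY; rewrite adj_sym uy in_setD uY (subsetP SU u uS) => /(_ isT).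
    by [].
  have S1 := meet X XU X0 nocross.
  have S2 : S :&: (U :\: X) != set0.
    apply: meet => //; first exact: subsetDl.
    move=> u w; rewrite adj_sym finset.setDDr finset.setDv finset.set0U => uD.
    by rewrite inE => /andP[wU wX]; apply: nocross.
  have small (Y : {set 'I_n}) : Y \subset S -> Y != set0 -> #|Y| < #|S| -> 2 * #|Y| <= #|nbr H Y|.
    move=> YS Y0 lt; rewrite leqNgt; apply/negP=> nY.
    have : P Y by rewrite /P nY andbT card_gt0 Y0 (leq_trans (ltnW lt) Sm).
    by move/minS; rewrite leqNgt lt.
  have SE : #|S :&: X| + #|S :&: (U :\: X)| = #|S|.
    rewrite -[RHS](cardsID X); congr (_ + _); apply: eq_card => v.
    by rewrite !inE; case: (v \in S); rewrite /= ?andbF ?andbT.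
  have N1 : nbr H (S :&: X) \subset W :&: X.
    apply/subsetP=> v /nbrP[vS [u]]; rewrite in_setI => /andP[uS uX] uv.
    have vU := stepU u v uS uv.
    have vX : v \in X.
      apply/negPn/negP=> vX; have := nocross u v uX; rewrite in_setD vX vU uv.
      by move/(_ isT).
    move: vS vU; rewrite !in_setI vX !andbT in_setU => /negPf -> /=.
    by [].
  have N2 : nbr H (S :&: (U :\: X)) \subset W :\: X.
    apply/subsetP=> v /nbrP[vS [u]]; rewrite in_setI => /andP[uS uX] uv.
    have vU := stepU u v uS uv.
    have vX : v \notin X.
      by apply/negP=> vX; have := nocross v u vX uX; rewrite adj_sym uv.
    have vS' : v \notin S by move: vS; rewrite in_setI in_setD vX vU !andbT.
    by move: vU; rewrite in_setD vX /= in_setU (negPf vS').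
  have WE := cardsID X W.
  have := subset_leq_card N1; have := subset_leq_card N2.
  have l1 : 0 < #|S :&: X| by rewrite card_gt0.
  have l2 : 0 < #|S :&: (U :\: X)| by rewrite card_gt0.
  have : 2 * #|S :&: X| <= #|nbr H (S :&: X)|.
    by apply: small; rewrite ?finset.subsetIl // -SE -[ltnLHS]addn0 ltn_add2l.
  have : 2 * #|S :&: (U :\: X)| <= #|nbr H (S :&: (U :\: X))|.
    by apply: small; rewrite ?finset.subsetIl // -SE -[ltnLHS]add0n ltn_add2r.
  move=> h2 h1 i2 i1; move: cN; rewrite ltnNge => /negP; apply.
  rewrite -SE mulnDr -/W -WE; apply: leq_add; first exact: leq_trans h1 i1.
  exact: leq_trans h2 i2.
have U0 : U != set0.
  by rewrite -card_gt0 cU; apply: leq_trans S0' (leq_addr _ _).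
have [T [TH TU cT]] := spanning_edges U0 conn.
have degU v : v \in S -> degree H v < #|U|.
  move=> vS; apply: proper_card; apply/properP; split.
    by apply/subsetP=> u; rewrite inE; apply: stepU.
  exists v; first exact: (subsetP SU).
  by rewrite inE; apply/negP=> /adj_neq; rewrite eqxx.
have full v : v \in S -> degree H v < 8 -> forall u, adj G v u -> adj H v u.
  by move=> vS dv; have [|//] := keep v; rewrite leqNgt dv.
have cU3 : #|U| < 3 * #|S| by rewrite cU mulSn ltn_add2l.
have S2 : 2 <= #|S|.
  rewrite ltnNge; apply/negP=> S1.
  have /cards1P[v SE] : #|S| == 1 by rewrite eqn_leq S1.
  have vS : v \in S by rewrite SE inE.
  have dv := degU v vS; have S1' : #|S| = 1 by rewrite SE cards1.
  have cU2 : #|U| <= 2 by move: cU3; rewrite S1'.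
  have le : degree G v <= degree H v.
    apply/subset_leq_card/subsetP=> u; rewrite !inE; apply: full => //.
    exact: leq_trans dv (leq_trans cU2 _).
  have h := leq_trans dG (min_degree_le G v).
  by have := leq_trans (leq_ltn_trans (leq_trans h le) dv) cU2; rewrite ltnn.
exists S, U, T; apply/andP; split.
  by rewrite /spot SU S2 Sm cU3 TU cT eqxx.
rewrite /isolated_spot (subset_trans TH HG) /=; apply/andP; split.
  rewrite /U boundary_disjoint; apply/forall_inP=> u uS; apply/forallP=> w.
  by apply/implyP=> uw; apply: stepU uS _; apply: adjS uw.
apply/implyP=> S3; rewrite /U boundary_disjoint.
apply/forall_inP=> u uS; apply/forallP=> w; apply/implyP=> uw.
apply: stepU (uS) _; apply: (full u uS).
  apply: leq_trans (degU u uS) _; rewrite -ltnS; apply: leq_trans cU3 _.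
  by rewrite (leq_mul2l 3 _ 3).
by apply: adjS uw; apply: finset.subsetUr.
Qed.

(** The two reasons for a graph with minimum degree at least 2 not to be Hamiltonian.
    The first layer, with at most eight further edges at each vertex, may fail to expand.
    Otherwise add to it a longest path of the whole graph: with these at most [9 * n]
    edges of the second layer there are many end pairs of longest paths, and none of them
    may be an edge of the whole graph. *)
Lemma dichotomy m G1 G2 : 0 < m -> 2 < n -> n < 6 * m ->
  2 <= min_degree (G1 :|: G2) -> ~~ hamiltonian (G1 :|: G2) ->
  (exists S U T, spot m S U T && isolated_spot G1 G2 S U T) \/
  (exists B, [/\ B \subset G2, #|B| <= 9 * n, m * m <= 4 * #|end_pairs (G1 :|: B)| &
     [disjoint end_pairs (G1 :|: B) & G1 :|: G2]]).
Proof.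
set G := G1 :|: G2 => m0 n3 nm dG nH.
have [B0 [B0G cB0 keep]] := keep_edges 8 G.
pose H0 := G1 :|: (B0 :&: G2).
have B0H : B0 \subset H0.
  apply/subsetP=> e eB; have := subsetP B0G e eB; rewrite !inE eB.
  by case/orP=> ->; rewrite ?orbT.
have G1H0 : G1 \subset H0 by apply: finset.subsetUl.
have H0G : H0 \subset G by apply: finset.setUS; apply: finset.subsetIr.
have [xH|nx] := pselect (expander m H0); last first.
  left; apply: (@nonexpander_spot m G1 G2 H0) => // v.
  have [d|a] := keep v; [left|right].
    apply: leq_trans d _; apply/subset_leq_card/subsetP=> u; rewrite !inE.
    exact: adjS.
  by move=> u /a; apply: adjS.
right; have [P lP] := longest_exists G.
have [B1 [B1G cB1 pB1]] := simple_path_edges lP.1.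
exists ((B0 :|: B1) :&: G2).
have sub0 : H0 \subset G1 :|: (B0 :|: B1) :&: G2.
  by apply: finset.setUS; apply: finset.setSI; apply: finset.subsetUl.
have sub1 : B1 \subset G1 :|: (B0 :|: B1) :&: G2.
  apply/subsetP=> e eB; have := subsetP B1G e eB; rewrite !inE eB orbT.
  by case/orP=> ->; rewrite ?orbT.
have subG : G1 :|: (B0 :|: B1) :&: G2 \subset G.
  by apply: finset.setUS; apply: finset.subsetIr.
split.
- exact: finset.subsetIr.
- apply: leq_trans (subset_leq_card (finset.subsetIl _ _)) _.
  rewrite cardsU (leq_trans (leq_subr _ _)) // mulSn addnC leq_add //.
  exact: leq_trans cB1 (simple_path_size lP.1).
- by apply: card_end_pairs => //; [apply: ltn_trans n3|apply: expanderS xH].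
have cG : cut_connected G.
  by apply: (expander_cut m0 nm); apply: expanderS xH.
apply/pred0P=> e /=; apply/negP=> /andP[+ eG].
rewrite inE => /asboolP[x [s [lH eE]]].
have := longest_sub subG (simple_pathS sub1 pB1) lP lH.
move/(longest_ends_nonadj n3 cG nH)/negP; apply.
by rewrite adj_sym; apply/adjP; exists e.
Qed.

End Dichotomy.

Local Open Scope ring_scope.

(** * The random graph as a union of two independent layers *)

Section ProductLaw.
Variable R : realType.

Lemma prod_le_powers (I : finType) (A B : {set I}) (a b : R) (f : I -> R) :
  [disjoint A & B] -> 0 <= a <= 1 -> 0 <= b <= 1 ->
  (forall i, 0 <= f i <= 1) -> (forall i, i \in A -> f i <= a) ->
  (forall i, i \in B -> f i <= b) ->
  \prod_i f i <= a ^+ #|A| * b ^+ #|B|.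
Proof.
move=> dAB /andP[a0 a1] /andP[b0 b1] f01 fa fb.
rewrite -2!prodr_const (big_mkcond (fun i => i \in A)) (big_mkcond (fun i => i \in B)).
rewrite -big_split /=; apply: ler_prod => i _.
have /andP[f0 f1] := f01 i; rewrite f0 /=.
have [iA|iA] := boolP (i \in A); first by rewrite (disjointFr dAB iA) mulr1 fa.
by rewrite mul1r; case: (boolP (i \in B)) => // iB; apply: fb.
Qed.

Variable n : nat.

(** Two independent copies of [G(n, 1 - s)]: an outcome records, for each possible edge,
    whether it is present in the first and in the second layer. *)
Definition outcome := {ffun edge n -> bool * bool}.
Implicit Types (w : outcome) (s : R) (A B : pred outcome).

Definition layer1 w : graph n := [set e | (w e).1].
Definition layer2 w : graph n := [set e | (w e).2].

Definition coin s (b : bool) : R := if b then 1 - s else s.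
Definition coins s (j : bool * bool) : R := coin s j.1 * coin s j.2.
Definition Pr2 s A : R := \sum_(w | A w) \prod_e coins s (w e).

Lemma coin_ge0 s b : 0 <= s <= 1 -> 0 <= coin s b.
Proof. by move=> /andP[s0 s1]; case: b; rewrite /= ?subr_ge0. Qed.

Lemma coins_ge0 s j : 0 <= s <= 1 -> 0 <= coins s j.
Proof. by move=> s01; apply: mulr_ge0; apply: coin_ge0. Qed.

Lemma sum_coins s (C : pred (bool * bool)) : \sum_(j | C j) coins s j =
  \sum_(a : bool) \sum_(b : bool | C (a, b)) coin s a * coin s b.
Proof.
rewrite (pair_big_dep xpredT (fun a b => C (a, b))) /=.
by apply: eq_big => -[a b].
Qed.

Lemma prob_ge0 s w : 0 <= s <= 1 -> 0 <= \prod_e coins s (w e).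
Proof. by move=> s01; apply: prodr_ge0 => e _; apply: coins_ge0. Qed.

Lemma Pr2_ge0 s A : 0 <= s <= 1 -> 0 <= Pr2 s A.
Proof. by move=> s01; apply: sumr_ge0 => w _; apply: prob_ge0. Qed.

Lemma Pr2_prod s (C : edge n -> pred (bool * bool)) :
  Pr2 s (fun w => [forall e, C e (w e)]) = \prod_e \sum_(j | C e j) coins s j.
Proof.
rewrite bigA_distr_big_dep; apply: eq_bigl => w.
by apply/forallP/familyP.
Qed.

Lemma Pr2T s : Pr2 s xpredT = 1.
Proof.
transitivity (Pr2 s (fun w => [forall e : edge n, xpredT (w e)])).
  by apply: eq_bigl => w; apply/esym/forallP.
rewrite (Pr2_prod s (fun=> xpredT)); apply: big1 => e _.
by rewrite sum_coins !big_bool /= /coin; ring.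
Qed.

Lemma Pr2_le s A B : 0 <= s <= 1 -> (forall w, A w -> B w) -> Pr2 s A <= Pr2 s B.
Proof.
move=> s01 AB; rewrite /Pr2 (big_mkcond A) (big_mkcond B) /=.
apply: ler_sum => w _; case: (boolP (A w)) => [/AB -> //|_].
by case: ifP => // _; apply: prob_ge0.
Qed.

Lemma eq_Pr2 s A B : A =1 B -> Pr2 s A = Pr2 s B.
Proof. by move=> AB; apply: eq_bigl. Qed.

Lemma Pr2_union s (I : finType) (P : pred I) A (B : I -> pred outcome) : 0 <= s <= 1 ->
  (forall w, A w -> exists2 i, P i & B i w) -> Pr2 s A <= \sum_(i | P i) Pr2 s (B i).
Proof.
move=> s01 AB; rewrite /Pr2 (exchange_big_dep xpredT) //= big_mkcond /=.
apply: ler_sum => w _; case: ifP => [/AB[i Pi Bi]|_]; last first.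
  by apply: sumr_ge0 => i _; apply: prob_ge0.
rewrite (bigD1 i) ?Pi //= lerDl; apply: sumr_ge0 => j _; exact: prob_ge0.
Qed.

Lemma Pr2_or s A B (C : pred outcome) : 0 <= s <= 1 ->
  (forall w, A w -> B w \/ C w) -> Pr2 s A <= Pr2 s B + Pr2 s C.
Proof.
move=> s01 ABC.
have := @Pr2_union s bool xpredT A (fun b => if b then B else C) s01.
rewrite big_bool /=; apply=> w /ABC[Bw|Cw]; by [exists true|exists false].
Qed.

(** An edge is missing from the union of the layers when it is missing from both. *)
Lemma Pr_gnp_layers s (A : pred (graph n)) :
  Pr_gnp (1 - s ^+ 2) A = Pr2 s (fun w => A (layer1 w :|: layer2 w)).
Proof.
rewrite /Pr2 (partition_big (fun w => layer1 w :|: layer2 w) A) //=.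
apply: eq_bigr => G AG.
pose C (e : edge n) (j : bool * bool) := (j.1 || j.2) == (e \in G).
have -> : \sum_(w | A (layer1 w :|: layer2 w) && (layer1 w :|: layer2 w == G))
    \prod_e coins s (w e) = Pr2 s (fun w => [forall e, C e (w e)]).
  apply: eq_bigl => w; apply/andP/forallP => [[_ /eqP GE] e|cw].
    by rewrite /C -GE !inE.
  have -> : layer1 w :|: layer2 w = G by apply/setP=> e; rewrite !inE; exact/eqP/cw.
  by rewrite AG eqxx.
rewrite Pr2_prod; apply: eq_bigr => e _.
rewrite sum_coins big_bool /C /bernoulli_pmf big_mkcond big_bool.
rewrite [X in _ = _ + X]big_mkcond big_bool /= /coin.
by case: (e \in G) => /=; rewrite expr2; ring.
Qed.

Lemma sum_layer_law s : \sum_(G : graph n) \prod_e coin s (e \in G) = 1.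
Proof.
transitivity (\prod_(e : edge n) (coin s true + coin s false)).
  by rewrite bigA_distr; apply: eq_bigr => G _; apply: eq_bigr => e _; case: ifP.
by apply: big1 => e _; rewrite /coin subrK.
Qed.

Lemma sum_subsets (x : R) : \sum_(B : graph n) x ^+ #|B| = (1 + x) ^+ #|{: edge n}|.
Proof.
rewrite -prodr_const addrC bigA_distr; apply: eq_bigr => B _.
by rewrite -big_mkcond /= prodr_const.
Qed.

(** Union bound over the first layer and over [B]. Given both, the edges of [B] must be
    present and those of [D] absent in the second layer, which is independent of the
    first; this uses that [B] and [D] are then disjoint. The number of small sets [B] is
    controlled by an exponential weight: [t^-1 ^+ (M - #|B|)] is at least 1 and turns the
    sum over small sets into a binomial sum over all sets. *)
Lemma Pr_avoid s M d (D : graph n -> graph n -> graph n) (t : R) :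
  0 <= s <= 1 -> 0 < t <= 1 ->
  Pr2 s (fun w => [exists B : graph n, [&& B \subset layer2 w, (#|B| <= M)%N,
     (d <= #|D (layer1 w) B|)%N & [disjoint D (layer1 w) B & layer2 w]]]) <=
  t^-1 ^+ M * (1 + t * (1 - s)) ^+ #|{: edge n}| * s ^+ d.
Proof.
move=> s01 /andP[t0 t1]; have /andP[s0 s1] := s01.
have r0 : 0 <= 1 - s by rewrite subr_ge0.
pose C (G B : graph n) (e : edge n) (j : bool * bool) :=
  [&& j.1 == (e \in G), (e \in B) ==> j.2 & (e \in D G B) ==> ~~ j.2].
pose P (GB : graph n * graph n) := [&& (#|GB.2| <= M)%N, (d <= #|D GB.1 GB.2|)%N &
  [disjoint GB.2 & D GB.1 GB.2]].
apply: le_trans (Pr2_union (P := P)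
   (B := fun GB w => [forall e, C GB.1 GB.2 e (w e)]) s01 _) _.
  move=> w /existsP[B /and4P[BG cB cD dj]]; exists (layer1 w, B).
    rewrite /P /= cB cD; apply/pred0P=> e /=; apply/negP=> /andP[/(subsetP BG) e2 eD].
    by have := disjointFr dj eD; rewrite e2.
  apply/forallP=> e; rewrite /C /= inE eqxx /=; apply/andP; split; apply/implyP.
    by move/(subsetP BG); rewrite inE.
  by move=> eD; have := disjointFr dj eD; rewrite inE => ->.
have bound (GB : graph n * graph n) : P GB ->
   Pr2 s (fun w => [forall e, C GB.1 GB.2 e (w e)]) <=
   (\prod_e coin s (e \in GB.1)) * (t^-1 ^+ M * (t * (1 - s)) ^+ #|GB.2| * s ^+ d).
  case: GB => G B /and3P[/= cB cD dj]; rewrite Pr2_prod.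
  have -> : \prod_e \sum_(j | C G B e j) coins s j =
     (\prod_e coin s (e \in G)) *
     \prod_e \sum_(b | ((e \in B) ==> b) && ((e \in D G B) ==> ~~ b)) coin s b.
    rewrite -big_split /=; apply: eq_bigr => e _.
    rewrite sum_coins !big_bool /C big_distrr /=; case: (e \in G) => /=.
      by rewrite [X in _ + X]big_pred0 ?addr0.
    by rewrite [X in X + _]big_pred0 ?add0r.
  apply: ler_wpM2l; first by apply: prodr_ge0 => e _; apply: coin_ge0.
  apply: le_trans (_ : (1 - s) ^+ #|B| * s ^+ #|D G B| <= _).
    apply: prod_le_powers => //; first by rewrite r0 gerBl.
    - move=> e; rewrite big_mkcond big_bool /=.
      by case: (e \in B); case: (e \in D G B);
        rewrite /= /coin ?addr0 ?add0r ?subrK ?lexx ?ler01 ?r0 ?s0 ?gerBl.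
    - move=> e eB; rewrite eB (disjointFr dj eB) big_mkcond big_bool /= addr0.
      by rewrite /coin.
    - move=> e eD; rewrite eD (disjointFl dj eD) big_mkcond big_bool /= add0r.
      by rewrite /coin.
  apply: ler_pM; rewrite ?exprn_ge0 //; last by apply: ler_wiXn2l.
  rewrite exprMn mulrA ler_peMl ?exprn_ge0 //.
  rewrite exprVn mulrC ler_pdivlMr ?exprn_gt0 // mul1r.
  by apply: ler_wiXn2l => //; apply: ltW.
apply: le_trans (ler_sum _ bound) _.
apply: le_trans (_ : \sum_(GB : graph n * graph n) (\prod_e coin s (e \in GB.1)) *
   (t^-1 ^+ M * (t * (1 - s)) ^+ #|GB.2| * s ^+ d) <= _).
  rewrite [leLHS]big_mkcond; apply: ler_sum => -[G B] _; case: ifP => // _.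
  apply: mulr_ge0; first by apply: prodr_ge0 => e _; apply: coin_ge0.
  by rewrite !mulr_ge0 ?exprn_ge0 ?invr_ge0 ?mulr_ge0 // ltW.
rewrite -(pair_bigA _ (fun G B : graph n => (\prod_e coin s (e \in G)) *
   (t^-1 ^+ M * (t * (1 - s)) ^+ #|B| * s ^+ d))) /=.
under eq_bigr => G _ do rewrite -big_distrr /= -big_distrl /= -big_distrr /= sum_subsets.
by rewrite -big_distrl /= sum_layer_law mul1r.
Qed.

End ProductLaw.

(** * First moment of the isolated spots *)

Section Spots.
Variables (R : realType) (n : nat).
Implicit Types (S U : {set 'I_n}) (T : graph n).
Local Open Scope nat_scope.

Lemma card_inside U : #|inside U| = 'C(#|U|, 2).
Proof.
rewrite -cards_draws -(card_imset _ val_inj); apply: eq_card => A.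
rewrite !inE; apply/imsetP/andP => [[e + ->]|[AU cA]].
  by rewrite inE => eU; split=> //; apply: (valP e).
by exists (exist (fun e : {set _} => #|e| == 2) A cA); rewrite ?inE.
Qed.

Lemma card_boundary S U : S \subset U -> #|S| * (n - #|U|) <= #|boundary S U|.
Proof.
move=> SU; pose f (p : 'I_n * 'I_n) := [set p.1; p.2].
have -> : #|S| * (n - #|U|) = #|f @: finset.setX S (~: U)|.
  rewrite card_in_imset ?cardsX.
    have := cardsC U; rewrite card_ord => cU; by rewrite -[X in _ * (X - _)]cU addKn.
  move=> [u w] [u' w'] /finset.setXP[/= uS wU] /finset.setXP[/= uS' wU'] /setP E.
  rewrite !finset.in_setC in wU wU'.
  have neq a b : a \in S -> b \notin U -> (a == b) = false.
    by move=> /(subsetP SU) aU bU; apply: contraNF bU => /eqP <-.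
  have := E u; rewrite !inE eqxx (neq u w') // orbF => /esym/eqP ->.
  by have := E w; rewrite !inE eqxx orbT [w == u']eq_sym (neq u' w) // => /esym/eqP ->.
rewrite -(card_imset (mem (boundary S U)) val_inj).
apply/subset_leq_card/subsetP => _ /imsetP[[u w] /finset.setXP[/= uS wU] ->].
have uw : u != w.
  by apply: contraTneq wU => <-; rewrite finset.in_setC negbK (subsetP SU).
have [e eE] := edge_of uw.
apply/imsetP; exists e => //; rewrite inE; apply/existsP; exists u; rewrite uS.
by apply/existsP; exists w; rewrite wU eE eqxx.
Qed.

Lemma boundary_inside S U T : T \subset inside U -> [disjoint T & boundary S U].
Proof.
move=> TU; apply/pred0P=> e /=; apply/negP=> /andP[/(subsetP TU)].
rewrite !inE => eU /existsP[u /andP[_ /existsP[w /andP[wU /eqP eE]]]].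
by move: eU wU; rewrite eE subUset !sub1set finset.in_setC => /andP[_ ->].
Qed.

Lemma Pr_isolated_spot (s : R) S U T c : (0 <= s <= 1)%R -> S \subset U -> T \subset inside U ->
  c = (if #|S| <= 3 then 2 else 1) ->
  (Pr2 s (fun w : outcome n => isolated_spot (layer1 w) (layer2 w) S U T) <=
   (1 - s ^+ 2) ^+ #|T| * s ^+ (c * #|S| * (n - #|U|)))%R.
Proof.
move=> s01 SU TU cE; have /andP[s0 s1] := s01.
pose C (e : edge n) (j : bool * bool) := ((e \in T) ==> j.1 || j.2) &&
  ((e \in boundary S U) ==> ~~ j.1 && ((#|S| <= 3) ==> ~~ j.2)).
rewrite (@eq_Pr2 _ _ s _ (fun w => [forall e, C e (w e)])); last first.
  move=> w; apply/and3P/forallP => [[Tw d1 d2] e|Cw].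
    apply/andP; split; apply/implyP=> eX.
      by have := subsetP Tw e eX; rewrite !inE.
    have := disjointFr d1 eX; rewrite inE => -> /=; apply/implyP=> c3.
    by have := disjointFr (implyP d2 c3) eX; rewrite inE => ->.
  split.
  - by apply/subsetP=> e eT; have /andP[] := Cw e; rewrite eT !inE.
  - apply/pred0P=> e /=; apply/negP=> /andP[eX]; rewrite inE => e1.
    by have /andP[_] := Cw e; rewrite eX e1.
  - apply/implyP=> c3; apply/pred0P=> e /=; apply/negP=> /andP[eX]; rewrite inE => e2.
    by have /andP[_] := Cw e; rewrite eX e2 c3 andbF.
rewrite Pr2_prod.
apply: le_trans (_ : ((1 - s ^+ 2) ^+ #|T| * (s ^+ c) ^+ #|boundary S U| <= _)%R).
  have s2 : (0 <= s ^+ 2 <= 1)%R by rewrite exprn_ge0 // exprn_ile1.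
  have r0 : (0 <= 1 - s)%R by rewrite subr_ge0.
  apply: prod_le_powers.
  - exact: boundary_inside.
  - by have /andP[a b] := s2; rewrite subr_ge0 b gerBl.
  - by rewrite exprn_ge0 // exprn_ile1.
  - move=> e; apply/andP; split; first by apply: sumr_ge0 => j _; apply: coins_ge0.
    apply: le_trans (_ : (\sum_j coins s j <= _)%R).
      rewrite big_mkcond /=; apply: ler_sum => j _; case: ifP => // _; exact: coins_ge0.
    by rewrite sum_coins !big_bool /= /coin; nra.
  - move=> e eT; rewrite (eq_bigl (fun j => j.1 || j.2)).
      rewrite sum_coins big_bool big_mkcond big_bool [X in (_ + X <= _)%R]big_mkcond big_bool.
      by rewrite /= /coin expr2; nra.
    by move=> j; rewrite /C eT (disjointFr (boundary_inside S TU) eT) andbT.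
  - move=> e eX; rewrite (eq_bigl (fun j => ~~ j.1 && ((#|S| <= 3) ==> ~~ j.2))).
      rewrite sum_coins big_bool big_mkcond big_bool [X in (_ + X <= _)%R]big_mkcond big_bool.
      by rewrite /= /coin cE; case: (#|S| <= 3); rewrite /= ?expr1 ?expr2; nra.
    by move=> j; rewrite /C eX (disjointFl (boundary_inside S TU) eX).
have s2 : (s ^+ 2 <= 1)%R by rewrite exprn_ile1.
apply: ler_wpM2l; first by rewrite exprn_ge0 // subr_ge0.
rewrite -exprM; apply: ler_wiXn2l => //.
by rewrite -mulnA leq_mul2l card_boundary ?orbT.
Qed.

(** The number of absent edges of an isolated spot with [t] vertices, as an exponent of
    [s]. Since [e >= 4] and [e > t / 3], it exceeds [3 * N] by [d * t], where [d] may be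
    of order [N]; this pays for the choice of the vertices and the edges of the spot. *)
Lemma spot_exponent t e N d : 4 <= e -> t < 3 * e -> 4 * t <= 3 * N ->
  32 * d <= N -> 1000 <= N -> 3 * N + 2 + d * t <= e * (N - t).
Proof.
move=> e4 te tN dN N0.
have h1 : 32 * (d * t) <= N * t by rewrite mulnA leq_mul2r dN orbT.
have [k kE] : exists k, N = t + k by exists (N - t); lia.
have -> : N - t = k by lia.
have [e50|e50] := leqP e 50; nia.
Qed.

(** A weak form of Stirling's formula, from [1 + 1 / t <= expR (1 / t)]. *)
Lemma expn_fact t : (t%:R ^+ t <= expR 1 ^+ t * t`!%:R :> R)%R.
Proof.
elim: t => [|t IH]; first by rewrite !expr0 mul1r.
have step : (t.+1%:R ^+ t <= expR 1 * t%:R ^+ t :> R)%R.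
  case: t {IH} => [|t]; first by rewrite !expr0 mulr1; apply: (le_trans _ (expR_ge1Dx 1)); lra.
  have t0 : (0 < t.+1%:R :> R)%R by rewrite ltr0n.
  have -> : (t.+2%:R = (1 + t.+1%:R^-1) * t.+1%:R :> R)%R.
    by rewrite mulrDl mul1r mulVf ?gt_eqF // natr1.
  rewrite exprMn ler_wpM2r ?exprn_ge0 ?ler0n //.
  apply: (@le_trans _ _ (expR (t.+1%:R^-1) ^+ t.+1)%R).
    by apply: lerXn2r; rewrite ?nnegrE ?expR_ge0 ?addr_ge0 ?invr_ge0 ?ler0n // expR_ge1Dx.
  by rewrite -expRM_natl mulr_natl -mulr_natr mulVf ?gt_eqF.
rewrite exprS factS natrM exprS.
apply: (@le_trans _ _ (t.+1%:R * (expR 1 * t%:R ^+ t))%R).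
  by rewrite ler_wpM2l ?ler0n.
rewrite mulrCA -!mulrA; apply: ler_wpM2l; first exact: expR_ge0.
by rewrite [leRHS]mulrCA; apply: ler_wpM2l; rewrite ?ler0n.
Qed.

(** There are at most [O(n) ^ t] ways to choose [t] vertices and [t - 1] of the pairs of
    these: the two factorials in the denominators absorb [t ^ (2 * t)]. *)
Lemma count_spots t : 0 < t -> ('C(n, t)%:R * 'C('C(t, 2), t.-1)%:R <=
  (expR 1 ^+ 2 * n%:R) ^+ t :> R)%R.
Proof.
move=> t0.
have ffl a b : 'C(a, b) * b`! <= a ^ b.
  rewrite bin_ffact; elim: b => [|b IH]; first by rewrite ffactn0.
  by rewrite ffactnSr expnSr leq_mul // leq_subr.
have mono a b u : a <= b -> a ^ u <= b ^ u.
  by move=> ab; elim: u => // u IH; rewrite !expnS leq_mul.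
have h : 'C(n, t) * 'C('C(t, 2), t.-1) * (t`! * t`!) <= n ^ t * (t ^ t * t ^ t).
  case: t t0 => // t _; rewrite [t.+1.-1]/=.
  have e1 := ffl n t.+1.
  have e2 : 'C('C(t.+1, 2), t) * t`! <= (t.+1 * t.+1) ^ t.
    apply: leq_trans (ffl _ _) _; apply: mono; rewrite mulnn.
    by apply: leq_trans (ffl t.+1 2); apply: leq_pmulr.
  have -> : 'C(n, t.+1) * 'C('C(t.+1, 2), t) * ((t.+1)`! * (t.+1)`!) =
      'C(n, t.+1) * (t.+1)`! * ('C('C(t.+1, 2), t) * t`! * t.+1).
    by rewrite [(t.+1)`!]factS; ring.
  apply: leq_mul => //; apply: (leq_trans (leq_mul e2 (leqnn _))).
  by rewrite expnMn !expnS; move: (t.+1 ^ t) => x; nia.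
have ft : (0 < t`!%:R :> R)%R by rewrite ltr0n fact_gt0.
rewrite -(ler_pM2r (mulr_gt0 ft ft)) -!natrM.
apply: (@le_trans _ _ ((n ^ t * (t ^ t * t ^ t))%:R)%R); first by rewrite ler_nat.
rewrite !natrM !natrX exprMn -exprM mulnC exprM [leRHS]mulrAC mulrC.
apply: ler_wpM2r; first by rewrite exprn_ge0 ?ler0n.
rewrite expr2 mulrACA; apply: ler_pM; rewrite ?exprn_ge0 ?ler0n //; exact: expn_fact.
Qed.

(** First moment bound. By [spot_exponent] and [count_spots], spots with [t] vertices contribute at
    most [K * s ^+ (3 * n + 2)] times the power [t - 1] of
    [K * (1 - s ^+ 2) * s ^+ d], so that the hypothesis on this ratio makes the sum over
    [t] geometric. *)
Lemma Pr_spot_le (s : R) m d : (0 <= s <= 1)%R -> 4 * m <= n -> 32 * d <= n -> 1000 <= n ->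
  let K := (2 * expR 1 ^+ 2 * n%:R : R)%R in
  (K * (1 - s ^+ 2) * s ^+ d <= 2^-1)%R ->
  (Pr2 s (fun w : outcome n => [exists S, [exists U, [exists T,
      spot m S U T && isolated_spot (layer1 w) (layer2 w) S U T]]]) <=
   2 * K * s ^+ (3 * n + 2))%R.
Proof.
move=> s01 mn dn n0 K hK; have /andP[s0 s1] := s01.
have p01 : (0 <= 1 - s ^+ 2 <= 1)%R.
  by rewrite subr_ge0 exprn_ile1 //= gerBl exprn_ge0.
have /andP[p0 p1] := p01.
pose P (i : {set 'I_n} * {set 'I_n} * graph n) := spot m i.1.2 i.1.1 i.2.
(* [g t] bounds the probability of a single spot with [t] vertices *)
pose g t : R := ((1 - s ^+ 2) ^+ t.-1 * s ^+ (3 * n + 2 + d * t))%R.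
have g0 t : (0 <= g t)%R by rewrite mulr_ge0 // exprn_ge0.
apply: le_trans (Pr2_union (P := P) (B := fun i w =>
   isolated_spot (layer1 w) (layer2 w) i.1.2 i.1.1 i.2) s01 _) _.
  move=> w /existsP[S /existsP[U /existsP[T /andP[h1 h2]]]].
  by exists (U, S, T).
have bound i : P i -> (Pr2 s (fun w : outcome n =>
   isolated_spot (layer1 w) (layer2 w) i.1.2 i.1.1 i.2) <= g #|i.1.1|)%R.
  case: i => -[U S] T /= /and5P[/= SU /andP[S2 Sm] U3 TU /eqP cT].
  apply: le_trans (@Pr_isolated_spot s S U T _ s01 SU TU erefl) _.
  rewrite /g -cT /=; apply: ler_wpM2l; first by rewrite exprn_ge0.
  apply: ler_wiXn2l => //; rewrite cT; apply: spot_exponent => //.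
  - case: (leqP #|S| 3) => h; last by rewrite mul1n.
    exact: (leq_mul (leqnn 2) S2).
  - apply: (leq_trans U3); rewrite leq_mul2l /=; case: ifP; by rewrite ?mul1n // leq_pmull.
  - apply: leq_trans (leq_mul (leqnn 4) (ltnW U3)) _.
    by rewrite mulnCA leq_mul2l /= (leq_trans _ mn) // leq_mul2l.
apply: le_trans (ler_sum _ bound) _.
(* [h t] is [g t] times the number of choices of [S] and of the edges, given [U] *)
pose h t : R := if t is t'.+1 then
  ((2 ^ t)%:R * 'C('C(t, 2), t')%:R * g t)%R else 0%R.
apply: (@le_trans _ _ (\sum_(U : {set 'I_n}) h #|U|)%R).
  apply: (@le_trans _ _ (\sum_(i : {set 'I_n} * {set 'I_n} * graph n |
     (i.1.2 \subset i.1.1) && ((i.2 \subset inside i.1.1) && (#|i.2|.+1 == #|i.1.1|)))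
     g #|i.1.1|)%R).
    rewrite big_mkcond [leRHS]big_mkcond; apply: ler_sum => i _.
    rewrite /P /spot; case: (_ \subset _) => //=.
    case: (2 <= #|_| <= _) => /=; last by case: ifP.
    by case: (_ < _) => //=; case: ifP.
  rewrite -(pair_big_dep (fun j : {set 'I_n} * {set 'I_n} => j.2 \subset j.1)
     (fun j (T : graph n) => (T \subset inside j.1) && (#|T|.+1 == #|j.1|))
     (fun (j : {set 'I_n} * {set 'I_n}) (_ : graph n) => g #|j.1|)) /=.
  rewrite -(pair_big_dep xpredT (fun U S : {set 'I_n} => S \subset U) (fun U S : {set 'I_n} =>
    \sum_(T : graph n | (T \subset inside U) && (#|T|.+1 == #|U|)) g #|U|)%R) /=.
  apply: ler_sum => U _; rewrite !sumr_const /=.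
  have -> : #|[pred S : {set 'I_n} | S \subset U]| = 2 ^ #|U|.
    by rewrite -card_powerset; apply: eq_card => S; rewrite !inE.
  case cU : #|U| => [|t] /=; rewrite -!mulrnA -[leLHS]mulr_natl.
    rewrite [X in X * _](_ : _ = 0)%N ?mul0n ?mul0r //.
    by apply: eq_card0 => T; apply/negbTE/negP=> /andP[].
  have -> : #|(fun T : {set edge n} => (T \subset inside U) && (#|T|.+1 == t.+1))| =
      'C('C(t.+1, 2), t).
    by rewrite -cU -card_inside -cards_draws; apply: eq_card => T; rewrite inE unfold_in cU eqSS.
  by rewrite -natrM mulnC.
rewrite (partition_big (fun U : {set 'I_n} => inord #|U| : 'I_n.+1) xpredT) //=.
have cle (U : {set 'I_n}) : #|U| < n.+1 by rewrite ltnS -[n in _ <= n]card_ord max_card.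
apply: (@le_trans _ _ (\sum_(t < n.+1) 'C(n, t)%:R * h t)%R).
  apply: ler_sum => t _; rewrite (eq_bigr (fun=> h t)); last first.
    by move=> U /eqP <-; rewrite inordK.
  rewrite sumr_const -[leLHS]mulr_natl.
  rewrite (_ : #|_| = 'C(n, t)) // -[n in 'C(n, _)]card_ord -card_draws.
  apply: eq_card => U; rewrite inE unfold_in.
  by have -> : \val (inord #|U| : 'I_n.+1) = #|U| by apply: inordK.
rewrite big_ord_recl /= mulr0 add0r.
apply: (@le_trans _ _ (\sum_(t < n) K * s ^+ (3 * n + 2) * 2^-1 ^+ t)%R).
  apply: ler_sum => t _; rewrite /bump /= add1n.
  have K0 : (0 <= K)%R by rewrite !mulr_ge0 ?ler0n ?exprn_ge0 ?expR_ge0.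
  apply: (@le_trans _ _ (K ^+ t.+1 * g t.+1)%R).
    rewrite mulrA; apply: ler_wpM2r => //.
    rewrite mulrCA natrX; apply: le_trans (ler_wpM2l _ (count_spots (ltn0Sn t))) _.
      by rewrite exprn_ge0.
    by rewrite -exprMn mulrA.
  rewrite /g /= exprS (exprD s (3 * n + 2)) (exprM s d) (exprS (s ^+ d)%R).
  rewrite (_ : (_ * _ = (K * s ^+ (3 * n + 2)) * 
      (s ^+ d * (K * (1 - s ^+ 2) * s ^+ d) ^+ t))%R); last first.
    by rewrite !exprMn; ring.
  apply: ler_wpM2l; first by rewrite mulr_ge0 ?exprn_ge0.
  apply: (@le_trans _ _ (1 * (K * (1 - s ^+ 2) * s ^+ d) ^+ t)%R).
    apply: ler_wpM2r; last by rewrite exprn_ile1 // exprn_ge0.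
    by rewrite exprn_ge0 // !mulr_ge0 ?exprn_ge0.
  rewrite mul1r; apply: lerXn2r; rewrite ?nnegrE ?invr_ge0 ?ler0n //.
  by rewrite !mulr_ge0 ?exprn_ge0.
rewrite -big_distrr /= -[leRHS]mulrA [leRHS]mulrC.
have K0 : (0 <= K * s ^+ (3 * n + 2))%R.
  by rewrite !mulr_ge0 ?ler0n ?exprn_ge0 ?expR_ge0.
apply: ler_wpM2l => //; have -> : (\sum_(t < n) 2^-1 ^+ t = 2 - 2 * 2^-1 ^+ n :> R)%R.
  elim: (n) => [|k IH]; first by rewrite big_ord0; lra.
  by rewrite big_ord_recr /= IH exprS; lra.
by rewrite gerBl mulr_ge0 ?exprn_ge0 ?invr_ge0.
Qed.

End Spots.

(** * A lower bound from isolated vertices *)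

Section IsolatedVertices.
Variables (R : realType) (n : nat).
Implicit Types (s : R) (u v : 'I_n) (X : graph n).

(** With [Y] the number of events that occur, [0 <= (1 - l * Y) ^+ 2] shows that the
    probability of [Y > 0] is at least the mean of [2 * l * Y - l ^+ 2 * Y ^+ 2]. The best
    [l] is the ratio of the first two moments. *)
Lemma Pr2_second_moment s (I : finType) (A : I -> pred (outcome n)) : 0 <= s <= 1 ->
  (\sum_i Pr2 s (A i)) ^+ 2 <=
  Pr2 s (fun w => [exists i, A i w]) * \sum_i \sum_j Pr2 s (fun w => A i w && A j w).
Proof.
move=> s01; set mu := (X in X ^+ 2); set P := (X in _ <= X * _); set nu := (X in _ <= _ * X).
pose Y (w : outcome n) : R := \sum_i (A i w)%:R.
pose pr (w : outcome n) : R := \prod_e coins s (w e).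
have pr0 w : 0 <= pr w by apply: prob_ge0.
have PrE (B : pred (outcome n)) : Pr2 s B = \sum_w (B w)%:R * pr w.
  by rewrite /Pr2 big_mkcond; apply: eq_bigr => w _; case: (B w); rewrite ?mul1r ?mul0r.
have muE : mu = \sum_w Y w * pr w.
  rewrite /mu; under eq_bigr do rewrite PrE.
  by rewrite exchange_big; apply: eq_bigr => w _; rewrite big_distrl.
have nuE : nu = \sum_w Y w ^+ 2 * pr w.
  rewrite /nu; under eq_bigr => i _ do (under eq_bigr do rewrite PrE; rewrite exchange_big).
  rewrite exchange_big; apply: eq_bigr => w _.
  rewrite expr2 big_distrl /= big_distrl /=; apply: eq_bigr => i _.
  rewrite big_distrr big_distrl /=; apply: eq_bigr => j _.
  by rewrite -natrM mulnb.
have key l : 2 * l * mu - l ^+ 2 * nu <= P.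
  rewrite muE nuE /P PrE !big_distrr /= -sumrB; apply: ler_sum => w _.
  rewrite !mulrA -mulrBl; apply: ler_wpM2r => //.
  case: (boolP [exists i, A i w]) => [_|nA].
    rewrite /=; have := sqr_ge0 (1 - l * Y w); lra.
  suff -> : Y w = 0 by rewrite !mulr0 subr0.
  apply: big1 => i _; case Ai: (A i w) => //.
  by case/negP: nA; apply/existsP; exists i.
have P0 : 0 <= P by apply: Pr2_ge0.
have nu0 : 0 <= nu by rewrite nuE; apply: sumr_ge0 => w _; rewrite mulr_ge0 ?sqr_ge0.
have [nuz|nunz] := eqVneq nu 0.
  have [->|mu0] := eqVneq mu 0; first by rewrite expr0n /= mulr_ge0.
  have := key ((P + 1) / (2 * mu)); rewrite nuz mulr0 subr0.
  suff -> : 2 * ((P + 1) / (2 * mu)) * mu = P + 1 by lra.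
  by field.
have nupos : 0 < nu by rewrite lt_neqAle eq_sym nunz.
have := key (mu / nu).
have -> : 2 * (mu / nu) * mu - (mu / nu) ^+ 2 * nu = mu ^+ 2 / nu by field.
by rewrite ler_pdivrMr.
Qed.

Definition star v : graph n := [set e : edge n | v \in val e].

Lemma card_star v : #|star v| = n.-1.
Proof.
have -> : n.-1 = #|[set [set v; u] | u in [set~ v]]|.
  rewrite card_in_imset; first by rewrite cardsC1 card_ord.
  move=> u w; rewrite !inE => uv wv /setP/(_ u); rewrite !inE eqxx orbT (negPf uv) /=.
  by move/esym/eqP.
rewrite -(card_imset (mem (star v)) val_inj); apply: eq_card => A.
apply/imsetP/imsetP => [[e + ->]|[u uv ->]].
  rewrite inE; have [a [b [ab eE]]] := edge_ends e; rewrite eE !inE => /orP[] /eqP vE.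
    by exists b; rewrite ?inE ?vE // eq_sym.
  by exists a; rewrite ?inE ?vE // finset.setUC.
have [e eE] : exists e : edge n, val e = [set v; u].
  by apply: edge_of; move: uv; rewrite !inE eq_sym.
by exists e; rewrite ?eE // inE eE !inE eqxx.
Qed.

Lemma card_star2 u v : u != v -> #|star u :|: star v| = (n.-1 + n.-1 - 1)%N.
Proof.
move=> uv; rewrite cardsU !card_star; congr (_ - _)%N.
have [e eE] := edge_of uv.
suff -> : star u :&: star v = [set e] by rewrite cards1.
apply/setP=> f; rewrite !inE.
apply/andP/eqP => [[uf vf]|->]; last by rewrite eE !inE !eqxx orbT.
apply: val_inj; rewrite eE; apply/esym/eqP; rewrite eqEcard subUset !sub1set uf vf /=.
by rewrite (eqP (valP f)) cards2 uv.
Qed.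

Lemma Pr_absent s X :
  Pr2 s (fun w : outcome n => [disjoint X & layer1 w :|: layer2 w]) = (s ^+ 2) ^+ #|X|.
Proof.
pose C (e : edge n) (j : bool * bool) := (e \in X) ==> ~~ j.1 && ~~ j.2.
rewrite (@eq_Pr2 _ _ s _ (fun w => [forall e, C e (w e)])); last first.
  move=> w; apply/idP/forallP => [dj e|Cw].
    by apply/implyP=> eX; have := disjointFr dj eX; rewrite !inE => /negbT; rewrite negb_or.
  apply/pred0P=> e /=; apply/negP=> /andP[eX]; rewrite !inE.
  by have /implyP/(_ eX) := Cw e; rewrite -negb_or => /negPf ->.
rewrite Pr2_prod -prodr_const [RHS]big_mkcond; apply: eq_bigr => e _.
rewrite /C sum_coins big_bool big_mkcond big_bool [X in _ + X = _]big_mkcond big_bool /=.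
by case: (e \in X); rewrite /= /coin ?expr2; ring.
Qed.

Lemma min_degree_isolated (G : graph n) v : [disjoint star v & G] -> (min_degree G < 2)%N.
Proof.
move=> dj; apply: leq_ltn_trans (min_degree_le G v) _.
suff -> : degree G v = 0%N by [].
apply: eq_card0 => u; apply/negbTE/negP; rewrite inE => /adjP[e eG eE].
by have := disjointFl dj eG; rewrite inE eE !inE eqxx.
Qed.

(** Isolated vertices already have degree less than 2. Two given vertices are isolated
    when [2 * n - 3] edges are missing, so the second moment of the number of isolated
    vertices, whose mean is [mu], is at most [mu + mu ^+ 2 / q]. *)
Lemma Pr_min_degree_lower s : 0 < s <= 1 -> (1 < n)%N ->
  1 <= Pr_gnp (1 - s ^+ 2) (fun G : graph n => (min_degree G < 2)%N) *
       ((n%:R * (s ^+ 2) ^+ n.-1)^-1 + (s ^+ 2)^-1).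
Proof.
move=> /andP[s0 s1] n1; have s01 : 0 <= s <= 1 by rewrite ltW.
have q0 : 0 < s ^+ 2 by rewrite exprn_gt0.
set q := s ^+ 2 in q0 *.
have n0 : 0 < n%:R :> R by rewrite ltr0n; lia.
set mu := n%:R * q ^+ n.-1.
have mu0 : 0 < mu by rewrite mulr_gt0 // exprn_gt0.
set P0 := Pr_gnp _ _.
pose A v (w : outcome n) := [disjoint star v & layer1 w :|: layer2 w].
have leP : Pr2 s (fun w => [exists v, A v w]) <= P0.
  rewrite /P0 Pr_gnp_layers; apply: Pr2_le => // w /existsP[v].
  exact: min_degree_isolated.
have P00 : 0 <= P0 by apply: le_trans leP; apply: Pr2_ge0.
have := Pr2_second_moment A s01.
have -> : \sum_i Pr2 s (A i) = mu.
  under eq_bigr do rewrite /A Pr_absent card_star.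
  by rewrite sumr_const card_ord /mu mulr_natl.
set nu := (X in _ <= _ * X).
have nuE : nu <= mu + mu ^+ 2 / q.
  have pair i j : Pr2 s (fun w => A i w && A j w) = (s ^+ 2) ^+ #|star i :|: star j|.
    rewrite -Pr_absent; apply: eq_Pr2 => w; rewrite /A -!setI_eq0 finset.setIUl.
    by rewrite finset.setU_eq0.
  have -> : mu + mu ^+ 2 / q = \sum_(i < n) (q ^+ n.-1 + \sum_(j < n) q ^+ (n.-1 + n.-1 - 1)).
    rewrite big_split /= !sumr_const card_ord -[X in _ = X + _]mulr_natl -[X in _ = _ + X]mulr_natl.
    rewrite -[X in _ = _ + _ * X]mulr_natl; congr (_ + _).
    have -> : (n.-1 + n.-1 - 1 = (n.-2 + n.-1))%N by lia.
    rewrite /mu (_ : q ^+ n.-1 = q * q ^+ n.-2); last by rewrite -exprS; congr (_ ^+ _); lia.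
    rewrite exprD (_ : q ^+ n.-1 = q * q ^+ n.-2); last by rewrite -exprS; congr (_ ^+ _); lia.
    by field; rewrite gt_eqF.
  apply: ler_sum => i _; rewrite (bigD1 i) //=; apply: lerD.
    by rewrite pair finset.setUid card_star.
  rewrite [leRHS](bigD1 i) //=; apply: ler_wpDl; first by rewrite exprn_ge0 // ltW.
  by apply: ler_sum => j ji; rewrite pair card_star2 // eq_sym.
move=> h.
have hP : mu ^+ 2 <= P0 * (mu + mu ^+ 2 / q).
  apply: (le_trans h); apply: ler_pM => //; first exact: Pr2_ge0.
  by apply: sumr_ge0 => i _; apply: sumr_ge0 => j _; apply: Pr2_ge0.
rewrite -(ler_pM2r (exprn_gt0 2 mu0)) mul1r.
apply: (le_trans hP); rewrite -[leRHS]mulrA; apply: ler_wpM2l => //.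
by rewrite mulrDl expr2 mulKf ?gt_eqF // mulrC.
Qed.

End IsolatedVertices.

(** * The atypical event *)

Section Deterministic.
Variable n : nat.
Implicit Types (G : graph n).
Local Open Scope nat_scope.

Lemma hamiltonian_min_degree G : hamiltonian G -> 2 <= min_degree G.
Proof.
move=> /existsP[c /and4P[c3 uc cyc /forallP allc]].
have n3 : 2 < n by rewrite size_tuple in c3.
have deg v : 2 <= degree G v.
  have [i s' rotE] := rot_to (allc v).
  have us' : uniq (v :: s') by rewrite -rotE rot_uniq.
  have cs' : cycle (adj G) (v :: s') by rewrite -rotE rot_cycle.
  have sz : size (v :: s') = size c by rewrite -rotE size_rot.
  case: s' us' cs' sz {rotE} => [|a [|b s']] us' cs' sz.
  - by rewrite -sz in c3.
  - by rewrite -sz in c3.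
  have ab : a != last b s'.
    by move: us'; rewrite /= => /and3P[_ + _]; apply: contraNneq => ->; apply: mem_last.
  have -> : 2 = #|[set a; last b s']| by rewrite cards2 ab.
  apply/subset_leq_card/subsetP=> u; rewrite !inE => /orP[] /eqP ->.
    by move: cs' => /= /andP[].
  by move: cs'; rewrite /= rcons_path => /and3P[_ _ /andP[_]]; rewrite adj_sym.
rewrite /min_degree; apply: (big_ind (fun k => 2 <= k)) => //; first exact: ltnW.
by move=> a b; rewrite leq_min => -> ->.
Qed.

Lemma hamiltonian_complete : 2 < n -> hamiltonian [set: edge n].
Proof.
move=> n3; have sz : size (enum 'I_n) == n by rewrite size_enum_ord.
apply/existsP; exists (Tuple sz); rewrite /hamilton_cycle /= size_enum_ord n3 enum_uniq /=.
apply/andP; split; last by apply/forallP=> v; rewrite mem_enum.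
have cmp u v : u != v -> adj [set: edge n] u v.
  by move=> /edge_of[e eE]; apply/adjP; exists e; rewrite ?in_setT.
have := enum_uniq 'I_n; move/eqP: sz.
case: (enum 'I_n) => [|x [|y s]] sz us; [by rewrite -sz in n3|by rewrite -sz in n3|].
rewrite /= cmp /=; last first.
  by move: us => /= /andP[]; rewrite inE negb_or => /andP[].
rewrite rcons_path cmp ?andbT; last first.
  by move: us => /= /andP[+ _]; rewrite eq_sym; apply: contraNneq => ->; apply: mem_last.
have : sorted (fun u v => u != v) (y :: s).
  by apply: pairwise_sorted; rewrite -uniq_pairwise; move: us => /= /andP[].
by apply: sub_path.
Qed.

Lemma card_edge : #|{: edge n}| = 'C(n, 2).
Proof.
rewrite card_sig -[n in 'C(n, _)]card_ord -card_draws.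
by apply: eq_card => A; rewrite !inE.
Qed.

End Deterministic.

Section Bad.
Variables (R : realType) (n : nat).
Implicit Type s : R.

(** The event that accounts for the difference between the two probabilities of the
    theorem. *)
Definition atypical (G : graph n) := ~~ hamiltonian G && (2 <= min_degree G)%N.

Lemma Pr_gnp_split s (A B C : pred (graph n)) :
  (forall G, A G = B G || C G) -> (forall G, ~~ (B G && C G)) ->
  Pr_gnp s A = Pr_gnp s B + Pr_gnp s C.
Proof.
move=> ABC BC; rewrite /Pr_gnp (bigID B) /=; congr (_ + _); apply: eq_bigl => G.
  by rewrite ABC; case: (B G); rewrite /= ?andbF.
by rewrite ABC; have := BC G; case: (B G); case: (C G).
Qed.

Lemma Pr_nonhamiltonian (p : R) : Pr_gnp p (fun G : graph n => ~~ hamiltonian G) =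
  Pr_gnp p (fun G : graph n => (min_degree G < 2)%N) + Pr_gnp p atypical.
Proof.
apply: Pr_gnp_split => G; rewrite /atypical ltnNge; have := @hamiltonian_min_degree n G.
  by case: (hamiltonian G) => [->|_] //=; case: (2 <= _)%N.
by rewrite andbCA andNb andbF.
Qed.

(** The sets tested for expansion have up to [n %/ 4] elements. Then sets of this size
    reach more than half of the vertices, and closed neighbourhoods of non-expanding sets
    still miss a quarter of them. *)
Lemma Pr_atypical_le s t : 0 <= s <= 1 -> 0 < t <= 1 -> (1000 <= n)%N ->
  let K := 2 * expR 1 ^+ 2 * n%:R in
  K * (1 - s ^+ 2) * s ^+ (n %/ 32) <= 2^-1 ->
  Pr_gnp (1 - s ^+ 2) atypical <= 2 * K * s ^+ (3 * n + 2) +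
    t^-1 ^+ (9 * n) * (1 + t * (1 - s)) ^+ 'C(n, 2) * s ^+ ((n %/ 4) * (n %/ 4) %/ 4).
Proof.
move=> s01 t01 n0 K hK; rewrite Pr_gnp_layers.
pose m := (n %/ 4)%N.
have m1 : (0 < m)%N by rewrite /m divn_gt0 // (leq_trans _ n0).
have m2 : (n < 6 * m)%N by rewrite /m; lia.
have n3 : (2 < n)%N by apply: leq_trans n0.
apply: le_trans (_ : Pr2 s (fun w => [exists S, [exists U, [exists T,
      spot m S U T && isolated_spot (layer1 w) (layer2 w) S U T]]]) +
   Pr2 s (fun w => [exists B : graph n, [&& B \subset layer2 w, (#|B| <= 9 * n)%N,
     (m * m %/ 4 <= #|end_pairs (layer1 w :|: B)|)%N &
     [disjoint end_pairs (layer1 w :|: B) & layer2 w]]]) <= _).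
  apply: Pr2_or => // w /andP[nH dG].
  have [[S [U [T h]]]|[B [B2 cB cD dj]]] := dichotomy m1 n3 m2 dG nH; [left|right].
    by do 3![apply/existsP; eexists]; exact: h.
  apply/existsP; exists B; rewrite B2 cB /=; apply/andP; split.
    by have := leq_div2r 4 cD; rewrite mulKn.
  by apply: disjointWr dj; apply: finset.subsetUr.
apply: lerD; first by apply: (@Pr_spot_le _ _ _ _ (n %/ 32)) => //; rewrite mulnC leq_trunc_div.
rewrite -card_edge.
exact: (@Pr_avoid _ _ s (9 * n) _ (fun G B => end_pairs (G :|: B)) t s01 t01).
Qed.

End Bad.

(** * Estimates in the sparse and the dense regime *)

Section Asymptotics.
Variable R : realType.
Implicit Types (s a r eps : R) (n : nat).

(** The reciprocal of the lower bound obtained for the probability that the minimum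
    degree is less than 2. *)
Definition inv_lower n s : R := (n%:R * (s ^+ 2) ^+ n.-1)^-1 + (s ^+ 2)^-1.

(** Sparse regime: [n * (1 - s) <= (3 / 8) * ln n]. The edge probability tends to 0, and
    the mean number of isolated vertices, about [n * s ^+ (2 * n)], is at least a fixed
    power of [n]. *)
Lemma inv_lower_sparse eps n s : 0 < eps <= 1 -> 0 < s <= 1 ->
  expR (8 * (n%:R * (1 - s))) <= n%:R ^+ 3 ->
  1 + (2 / eps) ^+ 16 + (8 / eps) ^+ 4 <= n%:R ->
  inv_lower n s - 1 <= eps.
Proof.
move=> /andP[e0 e1] /andP[s0 s1] hn hN.
have h1 : 0 < (2 / eps) ^+ 16 by rewrite exprn_gt0 ?divr_gt0.
have h2 : 0 < (8 / eps) ^+ 4 by rewrite exprn_gt0 ?divr_gt0.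
have n1 : 1 <= n%:R :> R by lra.
have n0 : 0 < n%:R :> R by lra.
set r := 1 - s in hn *; set a := n%:R * r in hn.
have r0 : 0 <= r by rewrite /r; lra.
have a0 : 0 <= a by rewrite mulr_ge0 // ltW.
have sE : s = 1 - r by rewrite /r; lra.
(* a fourth power of the average degree stays below [n ^+ 3], so [r] is small *)
have hr4 : n%:R * r ^+ 4 <= 1.
  have : (2 * a) ^+ 4 <= n%:R ^+ 3.
    apply: le_trans hn; rewrite (_ : 8 * a = 4%:R * (2 * a)); last by ring.
    rewrite expRM_natl; apply: lerXn2r; rewrite ?nnegrE ?expR_ge0 ?mulr_ge0 //.
    by have := expR_ge1Dx (2 * a); lra.
  rewrite /a !exprMn => h; have : n%:R ^+ 3 * (16 * (n%:R * r ^+ 4)) <= n%:R ^+ 3 * 1.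
    by move: h; rewrite mulr1; congr (_ <= _); ring.
  rewrite ler_pM2l ?exprn_gt0 // => h'.
  have : 0 <= n%:R * r ^+ 4 by rewrite mulr_ge0 ?exprn_ge0 // ltW.
  lra.
have hr : r <= eps / 8.
  rewrite leNgt; apply/negP=> hlt.
  have : (eps / 8) ^+ 4 < r ^+ 4 by rewrite ltrXn2r // divr_ge0 // ltW.
  have hp : (eps / 8) ^+ 4 * (8 / eps) ^+ 4 = 1.
    by rewrite -exprMn mulrA divfK // divff ?expr1n // gt_eqF.
  have p0 : 0 < (eps / 8) ^+ 4 by rewrite exprn_gt0 // divr_gt0.
  move=> hlt4; have : (eps / 8) ^+ 4 * (8 / eps) ^+ 4 < (eps / 8) ^+ 4 * n%:R.
    by rewrite ltr_pM2l //; lra.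
  have : (eps / 8) ^+ 4 * n%:R < r ^+ 4 * n%:R by rewrite ltr_pM2r.
  rewrite hp mulrC [r ^+ 4 * _]mulrC; lra.
have hr8 : r <= 1 / 8 by lra.
have q0 : 0 < s ^+ 2 by rewrite exprn_gt0.
have hq : (s ^+ 2)^-1 <= 1 + 4 * r.
  rewrite -div1r ler_pdivrMr // sE; nra.
have hs : s^-1 <= expR (5 / 4 * r).
  apply: le_trans (expR_ge1Dx _); rewrite -div1r ler_pdivrMr // sE; nra.
(* with [s^-1 <= expR (5 / 4 * r)] the hypothesis costs at most [n ^+ 15] out of [n ^+ 16] *)
have h16 : n%:R <= (n%:R * (s ^+ 2) ^+ n) ^+ 16.
  have hs32 : s^-1 ^+ (32 * n) <= n%:R ^+ 15.
    apply: (@le_trans _ _ (expR (5 / 4 * r) ^+ (32 * n))).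
      by apply: lerXn2r; rewrite ?nnegrE ?expR_ge0 ?invr_ge0 ?(ltW s0).
    rewrite -expRM_natl (_ : (32 * n)%:R * _ = 5%:R * (8 * a)); last first.
      by rewrite /a natrM; field.
    rewrite expRM_natl (exprM _ 3 5); apply: lerXn2r; rewrite ?nnegrE ?expR_ge0 ?exprn_ge0 //.
  have p0 : 0 < s ^+ (32 * n) by rewrite exprn_gt0.
  rewrite exprVn -div1r ler_pdivrMr // in hs32.
  have -> : (n%:R * (s ^+ 2) ^+ n) ^+ 16 = n%:R * (n%:R ^+ 15 * s ^+ (32 * n)).
    have -> : (32 * n = 2 * n * 16)%N by rewrite mulnAC.
    rewrite [s ^+ (_ * 16)]exprM [s ^+ (2 * n)]exprM exprMn mulrA.
    by congr (_ * _).
  by rewrite ler_peMr // ltW.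
have hE : (n%:R * (s ^+ 2) ^+ n.-1)^-1 <= eps / 2.
  have pE : 0 < n%:R * (s ^+ 2) ^+ n.-1 by rewrite mulr_gt0 // exprn_gt0.
  rewrite -(invf_div 2 eps) lef_pV2 ?posrE ?divr_gt0 //.
  apply: (@le_trans _ _ (n%:R * (s ^+ 2) ^+ n)).
    apply/ltW; rewrite -(@ltr_pXn2r _ 16) ?nnegrE ?divr_ge0 ?mulr_ge0 ?exprn_ge0
      ?(ltW s0) ?(ltW n0) ?(ltW e0) //.
    by apply: lt_le_trans h16; lra.
  apply: ler_wpM2l; first exact: ltW.
  by apply: ler_wiXn2l; rewrite ?leq_pred ?exprn_ge0 ?exprn_ile1 ?(ltW s0).
rewrite /inv_lower; lra.
Qed.

(** Dense regime: [n * (1 - s)], which up to a factor 2 is the average degree, exceeds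
    any constant [A] once [n] is large. *)
Lemma dense_average_degree (A : R) n s : expR (8 * A) <= n%:R -> 1 <= n%:R :> R ->
  n%:R ^+ 3 < expR (8 * (n%:R * (1 - s))) -> A < n%:R * (1 - s).
Proof.
move=> hA n1 hn; have : expR (8 * A) < expR (8 * (n%:R * (1 - s))).
  apply: le_lt_trans hn; apply: (le_trans hA).
  by rewrite exprS ler_peMr ?exprn_ege1 //; lra.
by rewrite ltr_expR; lra.
Qed.

Lemma expR_decay (s : R) (k : nat) : 0 <= s -> s ^+ k <= expR (- ((1 - s) * k%:R)).
Proof.
move=> s0; rewrite -mulNr mulrC expRM_natl.
apply: lerXn2r; rewrite ?nnegrE ?expR_ge0 //.
by have := expR_ge1Dx (- (1 - s)); lra.
Qed.

Lemma spot_ratio_small n s : 0 < s <= 1 -> (32 <= n)%N ->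
  8 * expR 1 ^+ 2 * 128 ^+ 2 <= n%:R * (1 - s) ->
  2 * expR 1 ^+ 2 * n%:R * (1 - s ^+ 2) * s ^+ (n %/ 32) <= 2^-1.
Proof.
move=> /andP[s0 s1] n32; set r := 1 - s; set a := n%:R * r => hA.
have e0 : 0 < expR 1 ^+ 2 :> R by rewrite exprn_gt0 ?expR_gt0.
have a0 : 0 < a by apply: lt_le_trans hA; rewrite !mulr_gt0.
have r0 : 0 <= r by rewrite /r; lra.
have hs : s ^+ (n %/ 32) <= expR (- (a / 64)).
  apply: le_trans (expR_decay _ (ltW s0)) _; rewrite ler_expR lerN2.
  have : n%:R <= 64 * (n %/ 32)%:R :> R by rewrite -natrM ler_nat; lia.
  move=> h; rewrite ler_pdivrMr // /a -/r -mulrA [n%:R * r]mulrC.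
  by apply: ler_wpM2l => //; lra.
have hq : 1 - s ^+ 2 <= 2 * r.
  by rewrite /r; nra.
have he : (a / 128) ^+ 2 <= expR (a / 64).
  rewrite (_ : a / 64 = 2%:R * (a / 128)); last by field.
  rewrite expRM_natl; apply: lerXn2r; rewrite ?nnegrE ?expR_ge0 ?divr_ge0 ?(ltW a0) //.
  by have := expR_ge1Dx (a / 128); lra.
have q0 : 0 <= 1 - s ^+ 2 by rewrite subr_ge0 exprn_ile1 // ltW.
apply: (@le_trans _ _ (2 * expR 1 ^+ 2 * n%:R * (2 * r) * expR (- (a / 64)))).
  by apply: ler_pM; rewrite ?mulr_ge0 ?exprn_ge0 ?expR_ge0 ?ler0n ?(ltW s0) //
    ler_wpM2l ?mulr_ge0 ?exprn_ge0 ?expR_ge0.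
rewrite expRN ler_pdivrMr ?expR_gt0 //.
apply: (@le_trans _ _ (2^-1 * (a / 128) ^+ 2)); last by rewrite ler_wpM2l.
rewrite (_ : 2 * _ * _ * (2 * r) = a * (4 * expR 1 ^+ 2)); last by rewrite /a; ring.
rewrite (_ : 2^-1 * (a / 128) ^+ 2 = a * (a / (2 * 128 ^+ 2))); last by field.
apply: ler_wpM2l; first exact: ltW.
by rewrite ler_pdivlMr ?mulr_gt0 ?exprn_gt0 //; lra.
Qed.

Lemma inv_lowerE n s : 0 < s -> (0 < n)%N ->
  inv_lower n s = s ^+ 2 / (n%:R * (s ^+ n) ^+ 2) + (s ^+ 2)^-1.
Proof.
move=> s0 n0; rewrite /inv_lower; congr (_ + _).
have -> : (s ^+ n) ^+ 2 = s ^+ 2 * (s ^+ 2) ^+ n.-1 by rewrite -exprS prednK // -!exprM mulnC.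
have n0' : n%:R != 0 :> R by rewrite pnatr_eq0 -lt0n.
by field; rewrite n0' ?expf_neq0 // gt_eqF.
Qed.

(** With [y = s ^+ n], the product is a multiple of [y * s ^+ 4 + n * y ^+ 3], and
    [y ^+ 8 < n ^- 3] in the dense regime. *)
Lemma spot_total_small eps n s : 0 < eps -> 0 < s <= 1 -> (0 < n)%N ->
  let eta := eps / (16 * expR 1 ^+ 2) in
  n%:R ^+ 3 < expR (8 * (n%:R * (1 - s))) -> eta^-1 <= n%:R * (1 - s) ->
  eta^-1 ^+ 8 < n%:R ->
  2 * (2 * expR 1 ^+ 2 * n%:R) * s ^+ (3 * n + 2) * inv_lower n s <= eps / 2.
Proof.
move=> e0 /andP[s0 s1] n0 eta hn ha h8; rewrite inv_lowerE //.
have ee0 : 0 < expR 1 ^+ 2 :> R by rewrite exprn_gt0 ?expR_gt0.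
have eta0 : 0 < eta by rewrite divr_gt0 ?mulr_gt0.
have etaE : eta = eps / (16 * expR 1 ^+ 2) by [].
clearbody eta.
have ieta0 : 0 < eta^-1 by rewrite invr_gt0.
have n0' : 0 < n%:R :> R by rewrite ltr0n.
set y := s ^+ n; have y0 : 0 < y by rewrite exprn_gt0.
set a := n%:R * (1 - s) in ha hn.
have ye : y <= expR (- a) by rewrite /a mulrC; apply: expR_decay; apply: ltW.
rewrite (_ : s ^+ (3 * n + 2) = y ^+ 3 * s ^+ 2); last by rewrite exprD mulnC exprM.
clearbody y.
have y1 : y <= eta.
  apply: (le_trans ye); rewrite expRN -[eta]invrK lef_pV2 ?posrE ?expR_gt0 //.
  by apply: (le_trans ha); have := expR_ge1Dx a; lra.
have y2 : n%:R * y ^+ 3 <= eta.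
  apply/ltW; rewrite -(@ltr_pXn2r _ 8) ?nnegrE ?mulr_ge0 ?exprn_ge0
    ?(ltW y0) ?(ltW n0') ?(ltW eta0) //.
  have h24 : (y ^+ 8) * n%:R ^+ 3 <= 1.
    apply: (@le_trans _ _ (expR (- a) ^+ 8 * expR (8 * a))).
      apply: ler_pM; rewrite ?exprn_ge0 ?(ltW y0) ?(ltW s0) ?(ltW n0') // ?(ltW hn) //.
      by apply: lerXn2r; rewrite ?nnegrE ?expR_ge0 ?(ltW y0).
    by rewrite -expRM_natl -expRD (_ : _ + _ = 0) ?expR0 //; ring.
  have h72 : ((y ^+ 8) * n%:R ^+ 3) ^+ 3 <= 1.
    by rewrite exprn_ile1 // mulr_ge0 ?exprn_ge0 ?(ltW y0) ?(ltW n0').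
  have : n%:R * (n%:R * y ^+ 3) ^+ 8 <= 1.
    by move: h72; congr (_ <= _); ring.
  have eta8 : eta ^+ 8 * eta^-1 ^+ 8 = 1 by rewrite -exprMn divff ?expr1n // gt_eqF.
  have : eta ^+ 8 * eta^-1 ^+ 8 < eta ^+ 8 * n%:R by rewrite ltr_pM2l // exprn_gt0.
  rewrite eta8 => g1 g2; have : n%:R * (n%:R * y ^+ 3) ^+ 8 < n%:R * eta ^+ 8.
    by rewrite [ltRHS]mulrC; apply: le_lt_trans g2 g1.
  by rewrite ltr_pM2l.
have -> : 2 * (2 * expR 1 ^+ 2 * n%:R) * (y ^+ 3 * s ^+ 2) *
    (s ^+ 2 / (n%:R * y ^+ 2) + (s ^+ 2)^-1) =
    4 * expR 1 ^+ 2 * (y * s ^+ 4 + n%:R * y ^+ 3).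
  by field; rewrite !gt_eqF.
have ys : y * s ^+ 4 <= eta.
  by apply: le_trans y1; rewrite ler_piMr ?exprn_ile1 // ltW.
apply: (@le_trans _ _ (4 * expR 1 ^+ 2 * (eta + eta))).
  by apply: ler_wpM2l; [rewrite mulr_ge0 // ltW|apply: lerD].
by rewrite etaE le_eqVlt; apply/orP; left; apply/eqP; field; rewrite gt_eqF ?expR_gt0.
Qed.

Lemma booster_exponent n : (2000 <= n)%N ->
  (n * n <= 128 * ((n %/ 4) * (n %/ 4) %/ 4 - 2 * n))%N.
Proof.
move=> n0; set m := (n %/ 4)%N; set z := (m * m %/ 4)%N.
have nm : (n <= 5 * m)%N by rewrite /m; lia.
have nn : (n * n <= 25 * (m * m))%N by apply: (leq_trans (leq_mul nm nm)); rewrite mulnACA.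
have mz : (m * m <= 4 * z + 3)%N by rewrite /z; lia.
have n2 : (2000 * n <= n * n)%N by rewrite leq_mul2r n0 orbT.
move: (n * n)%N (m * m)%N z nn mz n2 => X Y w; clear -n0; lia.
Qed.

(** Let [a = n * (1 - s)]. The absent pairs contribute at most [expR (- n * a / 128)], and
    the sum over the small edge sets at most [expR (n * a / 512)] times the [n]-th power
    of a constant; the latter is harmless because [a] is large. *)
Lemma booster_total_small eps t n s : 0 < eps -> 0 < t -> t = 1 / 512 ->
  0 < s <= 1 -> (2000 <= n)%N ->
  4 / eps <= n%:R -> 256 * (2 * t^-1 ^+ 9) <= n%:R * (1 - s) ->
  t^-1 ^+ (9 * n) * (1 + t * (1 - s)) ^+ 'C(n, 2) *
     s ^+ ((n %/ 4) * (n %/ 4) %/ 4) * inv_lower n s <= eps / 2.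
Proof.
move=> e0 t0 tE /andP[s0 s1] n0 hn ha; rewrite inv_lowerE ?(leq_trans _ n0) //.
have n0' : 0 < n%:R :> R by rewrite ltr0n (leq_trans _ n0).
set r := 1 - s in ha *; set a := n%:R * r in ha.
have r0 : 0 <= r by rewrite /r; lra.
set y := s ^+ n; have y0 : 0 < y by rewrite exprn_gt0.
have y1 : y <= 1 by rewrite exprn_ile1 // ltW.
have ys : y <= s by rewrite -[leRHS]expr1; apply: ler_wiXn2l; rewrite ?(ltW s0) ?(leq_trans _ n0).
pose D := ((n %/ 4) * (n %/ 4) %/ 4)%N; pose L := (D - 2 * n)%N.
have nL : (n * n <= 128 * L)%N by apply: booster_exponent.
have DE : D = (n * 2 + L)%N.
  by rewrite /L mulnC subnKC // ltnW // -subn_gt0 -/L -(ltn_pmul2l (isT : 0 < 128)%N) muln0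
    (leq_trans _ nL) // muln_gt0 (leq_trans _ n0).
rewrite -/D DE exprD exprM -/y.
have hL : s ^+ L <= expR (- (r * (n%:R ^+ 2 / 128))).
  apply: le_trans (expR_decay _ (ltW s0)) _; rewrite ler_expR lerN2 -/r.
  apply: ler_wpM2l => //; rewrite ler_pdivrMr // expr2 -!natrM ler_nat mulnC; exact: nL.
have hC : (1 + t * r) ^+ 'C(n, 2) <= expR (n%:R ^+ 2 * (t * r)).
  have c2 : ('C(n, 2) <= n * n)%N.
    by rewrite bin2 -divn2 (leq_trans (leq_div _ _)) // leq_mul // leq_pred.
  apply: (@le_trans _ _ (expR (t * r) ^+ 'C(n, 2))).
    by apply: lerXn2r; rewrite ?nnegrE ?expR_ge0 ?addr_ge0 ?mulr_ge0 ?(ltW t0) // expR_ge1Dx.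
  rewrite -expRM_natl ler_expR.
  by rewrite ler_wpM2r ?mulr_ge0 ?(ltW t0) // expr2 -natrM ler_nat.
have hsum : (1 + t * r) ^+ 'C(n, 2) * s ^+ L <= expR (- (a / 256)) ^+ n.
  apply: (@le_trans _ _ (expR (n%:R ^+ 2 * (t * r)) * expR (- (r * (n%:R ^+ 2 / 128))))).
    by apply: ler_pM; rewrite ?exprn_ge0 ?addr_ge0 ?mulr_ge0 ?(ltW t0) ?(ltW s0).
  rewrite -expRD -expRM_natl ler_expR /a.
  have : 0 <= r * n%:R ^+ 2 by rewrite mulr_ge0 ?exprn_ge0 ?(ltW n0').
  rewrite (_ : n%:R * - _ = - (r * n%:R ^+ 2 / 256)); last by field.
  rewrite tE (_ : n%:R ^+ 2 * (1 / 512 * r) = r * n%:R ^+ 2 / 512); last by field.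
  rewrite mulrA; lra.
set W := t^-1 ^+ 9 in ha *; have W0 : 0 < W by rewrite exprn_gt0 ?invr_gt0.
have hW : W * expR (- (a / 256)) <= 2^-1.
  rewrite expRN ler_pdivrMr ?expR_gt0 //.
  have := expR_ge1Dx (a / 256).
  have : 2 * W <= a / 256 by rewrite ler_pdivlMr ?ltr0n // mulrC.
  clear; lra.
have h2n : n%:R * 2^-1 ^+ n <= 1 :> R.
  rewrite exprVn ler_pdivrMr ?exprn_gt0 // mul1r -natrX ler_nat; exact/ltnW/ltn_expl.
have hx : y ^+ 2 * (s ^+ 2 / (n%:R * y ^+ 2) + (s ^+ 2)^-1) <= 2.
  have q1 : s ^+ 2 / n%:R <= 1.
    rewrite ler_pdivrMr // mul1r (@le_trans _ _ 1) ?exprn_ile1 ?(ltW s0) //.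
    by rewrite -[1]/(1%:R) ler_nat (leq_trans _ n0).
  have q2 : y ^+ 2 / s ^+ 2 <= 1.
    by rewrite ler_pdivrMr ?exprn_gt0 // mul1r; apply: lerXn2r; rewrite ?nnegrE ?(ltW s0) ?(ltW y0).
  rewrite (_ : _ * _ = s ^+ 2 / n%:R + y ^+ 2 / s ^+ 2); first by lra.
  by field; rewrite !gt_eqF.
rewrite exprM -/W; clearbody W.
set P := (1 + _) ^+ _ in hsum *; set Q := s ^+ L in hsum *; set X := (_ + _ : R) in hx *.
rewrite -/y (_ : _ * X = W ^+ n * (P * Q) * (y ^+ 2 * X)); last by ring.
have X0 : 0 <= y ^+ 2 * X.
  apply: mulr_ge0; first by rewrite exprn_ge0 // ltW.
  rewrite /X; apply: addr_ge0; last by rewrite invr_ge0 exprn_ge0 // ltW.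
  by apply: divr_ge0; rewrite ?mulr_ge0 ?exprn_ge0 ?(ltW s0) ?(ltW n0') ?(ltW y0).
have PQ0 : 0 <= P * Q.
  by rewrite mulr_ge0 // exprn_ge0 ?(ltW s0) // addr_ge0 // mulr_ge0 // ltW.
apply: (@le_trans _ _ ((2^-1) ^+ n * 2)).
  apply: ler_pM => //; first by rewrite mulr_ge0 // exprn_ge0 // ltW.
  apply: (@le_trans _ _ ((W * expR (- (a / 256))) ^+ n)).
    by rewrite exprMn ler_wpM2l // exprn_ge0 // ltW.
  apply: lerXn2r; rewrite ?nnegrE ?invr_ge0 ?ler0n //.
  by apply: mulr_ge0; [exact: ltW|exact: expR_ge0].
have : (2^-1) ^+ n <= n%:R^-1 :> R.
  by rewrite -[leRHS]div1r ler_pdivlMr // mulrC.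
have : n%:R^-1 <= eps / 4 by rewrite -(invf_div 4 eps) lef_pV2 ?posrE ?divr_gt0.
clear; lra.
Qed.

End Asymptotics.

(** * The atypical event is negligible *)

Section Negligible.
Variable R : realType.

Lemma Pr_gnp_ge0 n (p : R) (A : pred (graph n)) : 0 <= p <= 1 -> 0 <= Pr_gnp p A.
Proof.
move=> p01; apply: sumr_ge0 => G _; apply: prodr_ge0 => e _; exact: bernoulli_pmf_ge0.
Qed.

Lemma Pr_gnp_le1 n (s : R) (A : pred (graph n)) : 0 <= s <= 1 -> Pr_gnp (1 - s ^+ 2) A <= 1.
Proof. by move=> s01; rewrite Pr_gnp_layers -(Pr2T n s); apply: Pr2_le. Qed.

(** Both regimes together, uniformly in [s]. With [x] the reciprocal of the lower bound,
    so that [1 <= P0 * x]: in the sparse regime the atypical event is compared with the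
    complement, [1 - P0 <= P0 * (x - 1)], and [x - 1] is small; in the dense regime its
    bound is multiplied by [P0 * x], and the product with [x] is small. *)
Lemma atypical_negligible (eps : R) : 0 < eps <= 1 -> exists N, forall n s, (N <= n)%N ->
  0 < s <= 1 -> Pr_gnp (1 - s ^+ 2) (@atypical n) <=
    eps * Pr_gnp (1 - s ^+ 2) (fun G : graph n => (min_degree G < 2)%N).
Proof.
move=> e01; have /andP[e0 e1] := e01.
have [t [t0 t1 tE]] : exists t : R, [/\ 0 < t, t <= 1 & t = 1 / 512].
  by exists (1 / 512); split; lra.
set eta := eps / (16 * expR 1 ^+ 2).
(* [A] is the lower bound required of [n * (1 - s)], and [C] that required of [n] *)
pose A := Num.max (8 * expR 1 ^+ 2 * 128 ^+ 2) (Num.max (256 * (2 * t^-1 ^+ 9)) eta^-1).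
pose C := Num.max (Num.max (expR (8 * A)) (1 + (2 / eps) ^+ 16 + (8 / eps) ^+ 4))
                  (Num.max (4 / eps) (eta^-1 ^+ 8)).
exists (2000 + Num.bound C)%N => n s Nn s01; have /andP[s0 s1] := s01.
have n2000 : (2000 <= n)%N by apply: leq_trans Nn; apply: leq_addr.
have nC : C < n%:R.
  apply: lt_le_trans (archi_boundP _) _; last first.
    by rewrite ler_nat; apply: leq_trans Nn; apply: leq_addl.
  by rewrite /C !le_max expR_ge0.
have h8 : eta^-1 ^+ 8 < n%:R by apply: le_lt_trans nC; rewrite /C !le_max lexx !orbT.
have := ltW nC; rewrite /C !ge_max => /andP[/andP[hA hsp] /andP[h4 _]].
have n1 : 1 <= n%:R :> R by rewrite ler1n (leq_trans _ n2000).
have n1000 : (1000 <= n)%N by apply: leq_trans n2000.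
have s01' : 0 <= s <= 1 by rewrite ltW.
have r0 : 0 <= 1 - s by rewrite subr_ge0.
set P0 := Pr_gnp _ (fun G : graph n => (min_degree G < 2)%N).
have low : 1 <= P0 * inv_lower n s by apply: Pr_min_degree_lower => //; apply: leq_trans n2000.
have P00 : 0 <= P0.
  by apply: Pr_gnp_ge0; rewrite subr_ge0 exprn_ile1 ?(ltW s0) //= gerBl exprn_ge0 // ltW.
have total : Pr_gnp (1 - s ^+ 2) (@atypical n) <= 1 - P0.
  by rewrite lerBrDl -Pr_nonhamiltonian; apply: Pr_gnp_le1.
have [sparse|dense] := leP (expR (8 * (n%:R * (1 - s)))) (n%:R ^+ 3).
  have hx := inv_lower_sparse e01 s01 sparse hsp.
  apply: (le_trans total); apply: (@le_trans _ _ (P0 * (inv_lower n s - 1))).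
    by rewrite mulrBr mulr1 lerB.
  by rewrite mulrC ler_wpM2r.
have := ltW (dense_average_degree hA n1 dense); rewrite /A !ge_max => /and3P[a1 a2 a3].
have r1 : 2 * expR 1 ^+ 2 * n%:R * (1 - s ^+ 2) * s ^+ (n %/ 32) <= 2^-1.
  by apply: spot_ratio_small => //; apply: leq_trans n2000.
have t01 : 0 < t <= 1 by rewrite t0.
apply: (le_trans (Pr_atypical_le s01' t01 n1000 r1)).
have h1 := spot_total_small e0 s01 (leq_trans (isT : 0 < 2000)%N n2000) dense a3 h8.
have h2 := booster_total_small e0 t0 tE s01 n2000 h4 a2.
set F := (X in X + _); set Q := (X in _ + X); rewrite -/F in h1; rewrite -/Q in h2.
have F0 : 0 <= F.
  by rewrite /F mulr_ge0 ?exprn_ge0 ?(ltW s0) // mulr_ge0 // mulr_ge0 //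
    mulr_ge0 ?exprn_ge0 ?expR_ge0.
have Q0 : 0 <= Q.
  apply: mulr_ge0; last by rewrite exprn_ge0 // ltW.
  apply: mulr_ge0; first by rewrite exprn_ge0 // invr_ge0 ltW.
  by rewrite exprn_ge0 // addr_ge0 // mulr_ge0 // ltW.
apply: (@le_trans _ _ ((F + Q) * (P0 * inv_lower n s))).
  by rewrite ler_peMr // addr_ge0.
rewrite mulrCA [eps * P0]mulrC; apply: ler_wpM2l => //.
by rewrite mulrDl [leRHS]splitr; apply: lerD.
Qed.

Lemma atypical_size n (G : graph n) : atypical G -> (2 < n)%N.
Proof.
move=> /andP[_ dG]; have dn v : (degree G v < n)%N.
  rewrite -[n in (_ < n)%N]card_ord; apply: proper_card; apply/properP.
  split; first by apply/subsetP.
  by exists v => //; rewrite inE; apply/negP=> /adj_neq; rewrite eqxx.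
case: n G dG dn => [|n] G dG dn; first by move: dG; rewrite /min_degree big_ord0.
exact: leq_ltn_trans (leq_trans dG (min_degree_le G ord0)) (dn ord0).
Qed.

Lemma Pr_atypical_complete n : Pr_gnp (1 : R) (@atypical n) = 0.
Proof.
apply: big1 => G aG; have n3 := atypical_size aG.
have [e eG] : exists e, e \notin G.
  apply: contrapT => nex; have GT : G = [set: edge n].
    apply/setP=> e; rewrite finset.in_setT; apply: contrapT => /negP eG.
    by apply: nex; exists e.
  by move: aG; rewrite /atypical GT hamiltonian_complete.
by rewrite (bigD1 e) //= /bernoulli_pmf (negPf eG) subrr mul0r.
Qed.

Lemma Pr_atypical_eq0 n (s : R) : 0 <= s <= 1 ->
  Pr_gnp (1 - s ^+ 2) (fun G : graph n => (min_degree G < 2)%N) = 0 ->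
  Pr_gnp (1 - s ^+ 2) (@atypical n) = 0.
Proof.
rewrite le_eqVlt => /andP[/orP[/eqP <-|s0] s1] P0.
  by rewrite expr0n subr0 Pr_atypical_complete.
apply: big1 => G aG; have n1 : (1 < n)%N by apply: ltnW; apply: atypical_size aG.
by have := @Pr_min_degree_lower R n s; rewrite s0 s1 P0 mul0r ler10 => /(_ isT n1).
Qed.

End Negligible.

Local Open Scope classical_set_scope.
Local Open Scope ring_scope.

Theorem theorem1 (R : realType) (p : nat -> R)
    (hp : forall n : nat, 0 <= p n <= 1) :
  exists eps : nat -> R,
    eps @ \oo --> (0 : R) /\
    forall n : nat,
      Pr_gnp (p n) (fun G : graph n => ~~ hamiltonian G) =
      (1 + eps n) * Pr_gnp (p n) (fun G : graph n => (min_degree G < 2)%N).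
Proof.
pose s n := Num.sqrt (1 - p n).
have pE n : p n = 1 - s n ^+ 2.
  by have /andP[_ p1] := hp n; rewrite sqr_sqrtr ?subr_ge0 //; lra.
have s01 n : 0 <= s n <= 1.
  have /andP[p0 p1] := hp n; rewrite sqrtr_ge0 /= -sqrtr1 ler_sqrt //; lra.
pose P0 n := Pr_gnp (p n) (fun G : graph n => (min_degree G < 2)%N).
pose P1 n := Pr_gnp (p n) (@atypical n).
have P00 n : 0 <= P0 n by apply: Pr_gnp_ge0.
have P10 n : 0 <= P1 n by apply: Pr_gnp_ge0.
have P1z n : P0 n = 0 -> P1 n = 0.
  by rewrite /P0 /P1 pE; apply: Pr_atypical_eq0.
(* where [P0 n] vanishes so does [P1 n], and the value [P1 n / 0 = 0] is harmless *)
exists (fun n => P1 n / P0 n); split; last first.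
  move=> n; rewrite Pr_nonhamiltonian -/(P0 n) -/(P1 n).
  have [P0z|P0n] := eqVneq (P0 n) 0; first by rewrite P1z // P0z addr0 mulr0.
  by rewrite mulrDl mul1r divfK.
apply/cvgrPdist_le => e e0.
have e'01 : 0 < Num.min e 1 <= 1 by rewrite lt_min e0 ltr01 /= ge_min lexx orbT.
have [N HN] := atypical_negligible e'01.
exists N => // n /= Nn; rewrite sub0r normrN ger0_norm ?divr_ge0 //.
have [P0z|P0n] := eqVneq (P0 n) 0; first by rewrite P1z // mul0r ltW.
rewrite ler_pdivrMr; last by rewrite lt_neqAle eq_sym P0n P00.
have [sz|sn] := eqVneq (s n) 0.
  by rewrite /P1 pE sz expr0n subr0 Pr_atypical_complete mulr_ge0 // ltW.
apply: (@le_trans _ _ (Num.min e 1 * P0 n)).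
  rewrite /P1 /P0 pE; apply: HN => //.
  by have /andP[s0 s1] := s01 n; rewrite lt_neqAle eq_sym sn s0.
by rewrite ler_wpM2r // ge_min lexx.
Qed.
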